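(* There exists a universal constant $\hat b>0$ such that the following holds for every finite group $G$, every integer $n\ge 1$ and every real $c>0$ for which $k=\tfrac12 n\log n+cn$ is an integer. Let $P$ be the one-step distribution of the independent shuffles random walk on $G\wr S_n$ and let $U$ be the uniform probability measure on $G\wr S_n$ (both defined in the context). Then $$\|P^{*k}-U\|_{\mathrm{TV}}\ \le\ \hat b\,e^{-2c}.$$
   Context: The complete monomial group (wreath product) $G\wr S_n$ is the set $G^n\times S_n$, with elements written $(\vec x;\pi)$, $\vec x=(x_1,\dots,x_n)\in G^n$, $\pi\in S_n$, and multiplication $(\vec y;\sigma)(\vec x;\pi)=(y_1x_{\sigma^{-1}(1)},\dots,y_nx_{\sigma^{-1}(n)};\sigma\pi)$. It has $|G|^n n!$ elements and identity $(\vec e;e)$, where $\vec e=(e,\dots,e)$. The independent shuffles measure $P$ on $G\wr S_n$ is the probability mass function: - $P(\vec e;e)=\frac{1}{|G|n}$; - $P(\vec u;e)=\frac{1}{|G|n^2}$ if $\vec u\in G^n$ has exactly one non-identity entry; - $P(\vec v;\tau)=\frac{2}{|G|^2n^2}$ if $\tau=(p\ q)\in S_n$ is a transposition and all entries of $\vec v\in G^n$ outside positions $p$ and $q$ are the identity (the entries in positions $p,q$ being arbitrary); - $P(\vec x;\pi)=0$ otherwise. The uniform measure is $U(\vec x;\pi)=\frac{1}{|G|^n n!}$. For functions $P,Q$ on a finite group $\Gamma$: convolution is $P*Q(g)=\sum_{h\in\Gamma}P(gh^{-1})Q(h)$, and $P^{*k}$ is the $k$-fold convolution power; $\|P-Q\|_{\mathrm{TV}}=\max_{A\subseteq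 \Gamma}|P(A)-Q(A)|$. Here $\log$ is the natural logarithm. *)

(* Defs.v *)
From HB Require Import structures.
From mathcomp Require Import all_boot all_order all_algebra all_fingroup.
Set Implicit Arguments.
Unset Strict Implicit.
Unset Printing Implicit Defensive.
Import Order.TTheory GRing.Theory Num.Theory.
Local Open Scope group_scope.

(* A wrapper record, so that the wreath product does not inherit the
   componentwise (direct product) group structure of pairs. *)
Record wreath (gT : finGroupType) (n : nat) : predArgType :=
  Wreath { wr_vec : {ffun 'I_n -> gT}; wr_perm : 'S_n }.

Section WreathGroup.
Variables (gT : finGroupType) (n : nat).
Implicit Types x y z : wreath gT n.

Definition wreath_to_pair x := (wr_vec x, wr_perm x).
Definition wreath_of_pair (p : {ffun 'I_n -> gT} * 'S_n) := Wreath p.1 p.2.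

Lemma wreath_to_pairK : cancel wreath_to_pair wreath_of_pair.
Proof. by case. Qed.

Lemma wreath_of_pairK : cancel wreath_of_pair wreath_to_pair.
Proof. by case. Qed.

HB.instance Definition _ :=
  Finite.copy (wreath gT n) (can_type wreath_to_pairK).

(* (y; sigma) (x; pi) = (y_i x_{sigma^-1 i}; sigma pi), where sigma pi means
   "pi first, then sigma".  Products in 'S_n are read left to right
   (permM : (s * t) i = t (s i)), hence the reversed product of permutations. *)
Definition wreath_mul y x : wreath gT n :=
  Wreath [ffun i => wr_vec y i * wr_vec x ((wr_perm y)^-1 i)]
         (wr_perm x * wr_perm y).

Definition wreath_one : wreath gT n := Wreath [ffun=> 1] 1.

Definition wreath_inv x : wreath gT n :=
  Wreath [ffun i => (wr_vec x (wr_perm x i))^-1] (wr_perm x)^-1.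

Lemma wreath_mulA : associative wreath_mul.
Proof.
move=> z y x; congr Wreath; last by rewrite /= mulgA.
by apply/ffunP=> i; rewrite !ffunE /= invMg permM mulgA.
Qed.

Lemma wreath_mul1 : left_id wreath_one wreath_mul.
Proof.
case=> x p; congr Wreath; last by rewrite /= mulg1.
by apply/ffunP=> i; rewrite !ffunE /= invg1 perm1 mul1g.
Qed.

Lemma wreath_mulV : left_inverse wreath_one wreath_inv wreath_mul.
Proof.
move=> x; congr Wreath; last by rewrite /= mulgV.
by apply/ffunP=> i; rewrite !ffunE /= invgK mulVg.
Qed.

HB.instance Definition _ := Finite_isGroup.Build (wreath gT n)
  wreath_mulA wreath_mul1 wreath_mulV.

Lemma card_wreath : #|{: wreath gT n}| = (#|gT| ^ n * n`!)%N.
Proof.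
rewrite (bij_eq_card (Bijective wreath_to_pairK wreath_of_pairK)).
by rewrite card_prod card_ffun card_ord card_Sn.
Qed.

End WreathGroup.

Local Open Scope ring_scope.

Section FiniteGroupMeasures.
Variables (R : realFieldType) (gT : finGroupType).
Implicit Types P Q : gT -> R.

Definition convolution P Q : gT -> R :=
  fun g => \sum_(h : gT) P (g * h^-1)%g * Q h.

(* The 0-th power is the point mass at the identity. *)
Definition convolution_pow P (k : nat) : gT -> R :=
  iter k (convolution P) (fun g => (g == 1%g)%:R).

(* The default value 0 is attained at A = set0. *)
Definition tv_dist P Q : R :=
  \big[Num.max/0]_(A : {set gT}) `|\sum_(g in A) P g - \sum_(g in A) Q g|.

End FiniteGroupMeasures.

Section IndependentShuffles.
Variables (R : realFieldType) (gT : finGroupType) (n : nat).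

Definition independent_shuffles (g : wreath gT n) : R :=
  let x := wr_vec g in
  let s := wr_perm g in
  if g == 1%g then 1 / (#|gT|%:R * n%:R)
  else if (s == 1%g) && (#|[set i | x i != 1%g]| == 1%N) then
    1 / (#|gT|%:R * n%:R ^+ 2)
  else if [exists p, exists q, [&& p != q, s == tperm p q &
             [forall i, (i \notin [set p; q]) ==> (x i == 1%g)]]] then
    2 / (#|gT|%:R ^+ 2 * n%:R ^+ 2)
  else 0.

Definition uniform_wreath (g : wreath gT n) : R :=
  1 / (#|gT|%:R ^+ n * n`!%:R).

End IndependentShuffles.

(* Main.v *)
Require Import Defs.
From mathcomp Require Import all_boot all_order all_algebra all_fingroup.
From mathcomp Require Import spectral sesquilinear complex zify ring lra.
From mathcomp Require Import reals sequences exp.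
Set Implicit Arguments.
Unset Strict Implicit.
Unset Printing Implicit Defensive.
Import Order.TTheory GRing.Theory Num.Theory.
Local Open Scope ring_scope.

(** Write n for the number of positions.  Once a card has been touched its
    G-value is uniform, so up to the probability n(1-1/n)^(2k) <= e^(-2c) that
    some card is never touched, the walk is a random transposition walk on S_n
    with independent uniform G-values; this reduces the claim to S_n.

    On S_n, half the L1 distance is controlled by the trace of the 2k-th power of
    the transition matrix, i.e. by its eigenvalues with multiplicity.  Instead of
    characters, functions on S_n are filtered by degree: degree <= j means being a
    sum of functions invariant under Sym(S) with |S| = n - j.  This space has
    dimension at most C(n,j) n^j.  Let L be the sum of 1 - (p q) over ordered pairs
    (p,q).  If g is invariant under Sym(S), |S| = n - i, and is killed by all
    Sym(S') averages with |S'| = n - i + 1, then L g = 2i(n-i+1) g + L' g, where L'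
    is the same operator on the complement of S; L' >= 0, and by induction on the
    set L' is at least (2i-n)(i+2) when 2i > n.  So eigenvectors of degree j have
    L-eigenvalue at least max(2j(n-j+1), j(n+2)).  Negative eigenvalues of the
    walk are treated by the same bound for the representation twisted by the sign. *)

(** * Eigenvalues of sums of transpositions in an orthogonal representation *)

Section DotProduct.
Variables (R : realFieldType) (d : nat).
Implicit Types u v w : 'rV[R]_d.

Definition rdot u v : R := (u *m v^T) 0 0.

Lemma rdotE u v : rdot u v = \sum_i u 0 i * v 0 i.
Proof. by rewrite /rdot mxE; apply: eq_bigr => i _; rewrite mxE. Qed.

Lemma rdotC u v : rdot u v = rdot v u.
Proof. by rewrite !rdotE; apply: eq_bigr => i _; rewrite mulrC. Qed.

Lemma rdot_ge0 u : 0 <= rdot u u.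
Proof. by rewrite rdotE sumr_ge0 // => i _; rewrite -expr2 sqr_ge0. Qed.

Lemma rdot_eq0 u : (rdot u u == 0) = (u == 0).
Proof.
apply/eqP/eqP => [|->]; last by rewrite /rdot mul0mx mxE.
rewrite rdotE => /eqP; rewrite psumr_eq0 => [|i _]; last by rewrite -expr2 sqr_ge0.
move=> /allP h; apply/rowP => i; rewrite mxE.
by have := h i (mem_index_enum i); rewrite -expr2 sqrf_eq0 => /eqP.
Qed.

Lemma rdot_gt0 u : u != 0 -> 0 < rdot u u.
Proof. by move=> u0; rewrite lt_def rdot_ge0 rdot_eq0 u0. Qed.

Lemma rdotDl u v w : rdot (u + v) w = rdot u w + rdot v w.
Proof. by rewrite /rdot mulmxDl mxE. Qed.

Lemma rdotZl a u v : rdot (a *: u) v = a * rdot u v.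
Proof. by rewrite /rdot -scalemxAl mxE. Qed.

Lemma rdotNl u v : rdot (- u) v = - rdot u v.
Proof. by rewrite /rdot mulNmx mxE. Qed.

Lemma rdot_suml (I : finType) (P : pred I) (F : I -> 'rV[R]_d) v :
  rdot (\sum_(i | P i) F i) v = \sum_(i | P i) rdot (F i) v.
Proof. by rewrite /rdot mulmx_suml summxE. Qed.

Lemma rdot_mulmx u (A : 'M_d) v : rdot (u *m A) v = rdot u (v *m A^T).
Proof. by rewrite /rdot trmx_mul trmxK mulmxA. Qed.

End DotProduct.

Section OrthogonalRepresentation.
Variables (R : realFieldType) (T : finType) (d : nat).
Variable rho : {perm T} -> 'M[R]_d.
Hypothesis rho1 : rho 1%g = 1%:M.
Hypothesis rhoM : forall s t, rho (s * t)%g = rho s *m rho t.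
Hypothesis rhoV : forall s, (rho s)^T = rho s^-1%g.
Implicit Types (s t : {perm T}) (A B S : {set T}) (f g h : 'rV[R]_d).

(** Left unnormalised: up to the factor |S|!, this is the orthogonal projection onto the vectors
    fixed by [Sym S]. *)
Definition symmetrizer S := \sum_(s in Sym S) rho s.

Definition swap_laplacian A :=
  \sum_(p in A) \sum_(q in A) (1%:M - rho (tperm p q)).

Lemma Sym_sub A B s : A \subset B -> s \in Sym A -> s \in Sym B.
Proof. by move=> AB; rewrite !inE /perm_on => h; exact: subset_trans AB. Qed.

Lemma tperm_Sym A p q : p \in A -> q \in A -> tperm p q \in Sym A.
Proof.
move=> pA qA; apply: (@Sym_sub [set p; q]); last by rewrite inE tperm_on.
by apply/subsetP => x /set2P[] ->.
Qed.

Lemma symmetrizer_tr S : (symmetrizer S)^T = symmetrizer S.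
Proof.
rewrite /symmetrizer linear_sum /= (reindex_inj invg_inj) /=.
by apply: eq_big => [s|s _]; rewrite ?groupV // rhoV invgK.
Qed.

Lemma rho_symmetrizer S s : s \in Sym S ->
  rho s *m symmetrizer S = symmetrizer S.
Proof.
move=> sS; rewrite /symmetrizer mulmx_sumr [RHS](reindex_inj (mulgI s)) /=.
by apply: eq_big => [t|t _]; rewrite ?groupMl // rhoM.
Qed.

Lemma symmetrizer_rho S s : s \in Sym S ->
  symmetrizer S *m rho s = symmetrizer S.
Proof.
move=> sS; rewrite -[LHS]trmxK trmx_mul rhoV symmetrizer_tr.
by rewrite rho_symmetrizer ?groupV // symmetrizer_tr.
Qed.

Lemma symmetrizer_conj S s :
  rho s *m symmetrizer S = symmetrizer (s^-1%g @: S) *m rho s.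
Proof.
rewrite /symmetrizer mulmx_sumr mulmx_suml.
rewrite (reindex_inj (conjg_inj s)) /=.
apply: eq_big => [t|t _]; last by rewrite -!rhoM conjgE !mulgA mulgV mul1g.
rewrite !inE; apply/subsetP/subsetP => h x; rewrite inE => tx.
  have /h : s x \in [pred x | (t ^ s)%g x != x].
    by rewrite inE /= permJ (inj_eq perm_inj).
  by move=> sx; apply/imsetP; exists (s x); rewrite ?permK.
have /h : s^-1%g x \in [pred x | t x != x].
  rewrite inE /=; apply: contraNneq tx => e.
  by rewrite -[x](permKV s) permJ e.
by case/imsetP => y yS /perm_inj ->.
Qed.

Lemma symmetrizer_absorb A B : A \subset B ->
  symmetrizer A *m symmetrizer B = #|A|`!%:R *: symmetrizer B.
Proof.
move=> AB; rewrite {1}/symmetrizer mulmx_suml -card_Sym.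
rewrite (eq_bigr (fun=> symmetrizer B)); first by rewrite sumr_const scaler_nat.
by move=> s sA; rewrite rho_symmetrizer // (Sym_sub AB).
Qed.

Lemma symmetrizer_ker_sub f A B : A \subset B ->
  f *m symmetrizer A = 0 -> f *m symmetrizer B = 0.
Proof.
move=> AB fA; have : #|A|`!%:R *: (f *m symmetrizer B) = 0.
  by rewrite scalemxAr -(symmetrizer_absorb AB) mulmxA fA mul0mx.
move/eqP; rewrite scaler_eq0 pnatr_eq0 => /orP[/eqP|/eqP //].
by have := fact_gt0 #|A|; lia.
Qed.

Lemma symmetrizer1 x : symmetrizer [set x] = 1%:M.
Proof.
rewrite /symmetrizer (big_pred1 1%g) ?rho1 // => s /=.
apply/idP/eqP => [|->]; last exact: group1.
by rewrite inE => /perm_on_id; apply; rewrite cards1.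
Qed.

Lemma symmetrizer0 : symmetrizer set0 = 1%:M.
Proof.
rewrite /symmetrizer (big_pred1 1%g) ?rho1 // => s /=.
apply/idP/eqP => [|->]; last exact: group1.
by rewrite inE => /perm_on_id; apply; rewrite cards0.
Qed.

(** The symmetrizer is symmetric and its square is |S|! times itself, so the form is a squared norm
    up to a positive factor. *)
Lemma symmetrizer_ge0 f S : 0 <= rdot (f *m symmetrizer S) f.
Proof.
have fg : 0 < #|S|`!%:R :> R by rewrite ltr0n fact_gt0.
rewrite -(pmulr_rge0 _ fg) -rdotZl scalemxAr -symmetrizer_absorb //.
by rewrite mulmxA rdot_mulmx symmetrizer_tr rdot_ge0.
Qed.

(* Coset decomposition of [Sym (u |: S)] along [Sym S], indexed by the image of [u]. *)
Lemma symmetrizerU1 u S : u \notin S ->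
  symmetrizer (u |: S) =
  symmetrizer S *m (1%:M + \sum_(v in S) rho (tperm u v)).
Proof.
move=> uS; transitivity (symmetrizer S *m \sum_(v in u |: S) rho (tperm u v)).
  rewrite {1}/symmetrizer (partition_big (fun s => s u) (mem (u |: S))) /=; last first.
    by move=> s; rewrite inE => h; rewrite perm_closed ?setU11.
  rewrite mulmx_sumr; apply: eq_bigr => v vS.
  rewrite /symmetrizer mulmx_suml (reindex_inj (mulIg (tperm u v))) /=.
  apply: eq_big => [s|s _]; last by rewrite rhoM.
  rewrite permM groupMr ?tperm_Sym ?setU11 //.
  apply/andP/idP => [[sS /eqP e]|sS].
    have su : s u = u by rewrite -[s u](tpermK u v) e tpermR.
    rewrite inE; apply/subsetP => x; rewrite inE => sx.
    move: sS; rewrite inE => /subsetP /(_ x); rewrite inE sx => /(_ isT).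
    by rewrite !inE => /orP[/eqP xu|//]; rewrite xu su eqxx in sx.
  split; first by apply: Sym_sub sS; rewrite subsetUr.
  by move: sS; rewrite inE => /out_perm -> //; rewrite tpermL.
by rewrite big_setU1 //= tperm1 rho1.
Qed.

Lemma invariant_symmetrizer g S : (forall s, s \in Sym S -> g *m rho s = g) ->
  g *m symmetrizer S = #|S|`!%:R *: g.
Proof.
move=> gS; rewrite /symmetrizer mulmx_sumr -card_Sym.
by rewrite (eq_bigr (fun=> g)) // sumr_const scaler_nat.
Qed.

Lemma invariant_symmetrizerU1 g u S : u \notin S ->
  (forall s, s \in Sym S -> g *m rho s = g) ->
  g *m symmetrizer (u |: S) =
  #|S|`!%:R *: (g + \sum_(v in S) g *m rho (tperm u v)).
Proof.
move=> uS gS; rewrite symmetrizerU1 // mulmxA invariant_symmetrizer //.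
by rewrite -scalemxAl mulmxDr mulmx1 mulmx_sumr.
Qed.

Lemma symmetrizerU1_eq0 g u S : u \notin S ->
  (forall s, s \in Sym S -> g *m rho s = g) ->
  g *m symmetrizer (u |: S) = 0 ->
  \sum_(v in S) g *m rho (tperm u v) = - g.
Proof.
move=> uS gS; rewrite invariant_symmetrizerU1 // => /eqP.
rewrite scaler_eq0 pnatr_eq0 eqn0Ngt fact_gt0 /= addrC addr_eq0.
by move/eqP.
Qed.

Lemma rho_swap_laplacian A s : s \in Sym A ->
  rho s *m swap_laplacian A = swap_laplacian A *m rho s.
Proof.
rewrite inE => sA; rewrite /swap_laplacian mulmx_sumr mulmx_suml.
rewrite (reindex_inj (@perm_inj _ s)) /=.
apply: eq_big => [p|p pA]; first by rewrite perm_closed.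
rewrite mulmx_sumr mulmx_suml (reindex_inj (@perm_inj _ s)) /=.
apply: eq_big => [q|q qA]; first by rewrite perm_closed.
rewrite mulmxBr mulmxBl mulmx1 mul1mx -!rhoM -tpermJ conjgE.
by rewrite !mulgA mulgV mul1g.
Qed.

Lemma symmetrizer_swap_laplacian A S : S \subset A ->
  symmetrizer S *m swap_laplacian A = swap_laplacian A *m symmetrizer S.
Proof.
move=> SA; rewrite /symmetrizer mulmx_suml mulmx_sumr; apply: eq_bigr => s sS.
by rewrite rho_swap_laplacian // (Sym_sub SA).
Qed.

(** For a swap t, [1%:M - rho t] is symmetric and its square is twice itself, so every pair
    contributes half a squared norm. *)
Lemma swap_laplacian_ge0 f A : 0 <= rdot (f *m swap_laplacian A) f.
Proof.
rewrite /swap_laplacian mulmx_sumr rdot_suml sumr_ge0 // => p _.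
rewrite mulmx_sumr rdot_suml sumr_ge0 // => q _.
set t := tperm p q; set v := f *m (1%:M - rho t).
have : 0 <= rdot v v by exact: rdot_ge0.
have -> : rdot v v = 2 * rdot v f; last by lra.
rewrite {2}/v [rdot v (f *m _)]rdotC rdot_mulmx linearB /= trmx1 rhoV tpermV.
have -> : v *m (1%:M - rho t) = 2 *: v.
  rewrite /v -mulmxA scalemxAr; congr (_ *m _).
  rewrite mulmxBr mulmx1 mulmxBl mul1mx -rhoM tperm2 rho1.
  by rewrite opprB -[2%:R]/(1 + 1) scalerDl scale1r.
by rewrite rdotC rdotZl.
Qed.

Lemma swap_laplacian_split A S : S \subset A ->
  swap_laplacian A = swap_laplacian S + swap_laplacian (A :\: S) +
    2 *: \sum_(u in A :\: S) \sum_(v in S) (1%:M - rho (tperm u v)).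
Proof.
move=> SA; rewrite /swap_laplacian.
have split (F : T -> 'M[R]_d) :
  \sum_(p in A) F p = \sum_(p in S) F p + \sum_(p in A :\: S) F p.
  rewrite (big_setID S) /=; congr (_ + _); apply: eq_bigl => x.
  by rewrite inE; case: (boolP (x \in S)) => [/(subsetP SA)->|]; rewrite ?andbF.
rewrite split (eq_bigr _ (fun p _ => split _)) /=.
rewrite [X in _ + X](eq_bigr _ (fun p _ => split _)) /= !big_split /=.
have -> : \sum_(i in S) \sum_(j in A :\: S) (1%:M - rho (tperm i j)) =
  \sum_(j in A :\: S) \sum_(i in S) (1%:M - rho (tperm j i)).
  rewrite exchange_big; apply: eq_bigr => j _; apply: eq_bigr => i _.
  by rewrite tpermC.
set X := \sum_(i in S) _; set Y := \sum_(j in A :\: S) _.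
set Z := \sum_(i in A :\: S) \sum_(j in A :\: S) _.
rewrite -[2%:R]/(1 + 1) scalerDl scale1r -!addrA; congr (_ + _).
by rewrite [RHS]addrC addrA.
Qed.

Lemma invariant_swap_laplacian g S :
  (forall s, s \in Sym S -> g *m rho s = g) -> g *m swap_laplacian S = 0.
Proof.
move=> gS; rewrite /swap_laplacian mulmx_sumr big1 // => p pS.
rewrite mulmx_sumr big1 // => q qS.
by rewrite mulmxBr mulmx1 gS ?subrr // tperm_Sym.
Qed.

(** Pairs inside S contribute nothing. For u outside S, the symmetrizer of [u |: S] kills g, so the
    swaps of u with S sum to [- g] and u contributes (|S| + 1) g, twice because pairs are
    ordered. *)
Lemma swap_laplacian_extremal g A S : S \subset A ->
  (forall s, s \in Sym S -> g *m rho s = g) ->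
  (forall u, u \in A :\: S -> g *m symmetrizer (u |: S) = 0) ->
  g *m swap_laplacian A =
  (2 * #|A :\: S| * #|S|.+1)%:R *: g + g *m swap_laplacian (A :\: S).
Proof.
move=> SA gS gU; rewrite (swap_laplacian_split SA) !mulmxDr.
rewrite invariant_swap_laplacian // add0r addrC; congr (_ + _).
rewrite -scalemxAr mulmx_sumr (eq_bigr (fun=> #|S|.+1%:R *: g)) => [|u uA].
  by rewrite sumr_const -scaler_nat !scalerA -!natrM mulnA.
rewrite mulmx_sumr (eq_bigr (fun v => g - g *m rho (tperm u v))); last first.
  by move=> v _; rewrite mulmxBr mulmx1.
rewrite sumrB sumr_const symmetrizerU1_eq0 //; first last.
- exact: gU.
- by move: uA; rewrite inE => /andP[].
by rewrite opprK -mulrSr scaler_nat.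
Qed.

(* If [B] is larger than [S], the two positivity constraints on the sum of the
   swaps between [S] and [B] are incompatible unless the vector vanishes. *)
Lemma disjoint_symmetrizer_eq0 h S B : [disjoint S & B] -> (#|S| < #|B|)%N ->
  (forall s, s \in Sym S -> h *m rho s = h) ->
  (forall s, s \in Sym B -> h *m rho s = h) ->
  (forall u, u \in B -> h *m symmetrizer (u |: S) = 0) -> h = 0.
Proof.
move=> dSB SB hS hB hU; apply/eqP; rewrite -rdot_eq0 eq_le rdot_ge0 andbT.
have notS u : u \in B -> u \notin S by move=> uB; rewrite (disjointFl dSB).
have notB v : v \in S -> v \notin B by move=> vS; rewrite (disjointFr dSB).
have e1 : \sum_(u in B) \sum_(v in S) rdot (h *m rho (tperm u v)) h =
    - (#|B|%:R * rdot h h).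
  rewrite (eq_bigr (fun=> - rdot h h)) => [|u uB].
    by rewrite sumr_const mulNrn mulr_natl.
  by rewrite -rdot_suml symmetrizerU1_eq0 ?rdotNl // ?notS // hU.
have e2 : 0 <= #|S|%:R * rdot h h +
    \sum_(v in S) \sum_(u in B) rdot (h *m rho (tperm v u)) h.
  rewrite mulr_natl -sumr_const -big_split /=; apply: sumr_ge0 => v vS.
  have := symmetrizer_ge0 h (v |: B).
  rewrite invariant_symmetrizerU1 ?notB // rdotZl pmulr_rge0; last first.
    by rewrite ltr0n fact_gt0.
  by rewrite rdotDl rdot_suml.
have e3 : \sum_(v in S) \sum_(u in B) rdot (h *m rho (tperm v u)) h =
  \sum_(u in B) \sum_(v in S) rdot (h *m rho (tperm u v)) h.
  by rewrite exchange_big; do 2! (apply: eq_bigr => ? _); rewrite tpermC.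
move: e2; rewrite e3 e1 -mulrBl -[_ - _]opprK opprB mulNr oppr_ge0.
by rewrite pmulr_rle0 // subr_gt0 ltr_nat.
Qed.

(** Orthogonality of f to all vectors fixed by some [Sym B] with B an m-subset of A; by
    [symmetrizer_ker_sub] the larger subsets are then covered too. *)
Definition killed A m f :=
  forall B, B \subset A -> #|B| = m -> f *m symmetrizer B = 0.

Lemma killed_rho A m f s : s \in Sym A -> killed A m f -> killed A m (f *m rho s).
Proof.
rewrite inE => sA fk B BA Bm; rewrite -mulmxA symmetrizer_conj mulmxA fk ?mul0mx //.
  by rewrite -(im_perm_on (perm_onV sA)) imsetS.
by rewrite card_imset //; exact: perm_inj.
Qed.

Lemma killed_symmetrizer A m f S : S \subset A ->
  killed A m f -> killed A m (f *m symmetrizer S).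
Proof.
move=> SA fk B BA Bm; have -> : f *m symmetrizer S = \sum_(s in Sym S) f *m rho s.
  by rewrite mulmx_sumr.
rewrite mulmx_suml big1 // => s sS.
exact: (killed_rho (Sym_sub SA sS) fk BA Bm).
Qed.

Lemma symmetrizer_invariant f S s : s \in Sym S ->
  f *m symmetrizer S *m rho s = f *m symmetrizer S.
Proof. by move=> sS; rewrite -mulmxA symmetrizer_rho. Qed.

Lemma eigen_ge0 f A th : f != 0 -> f *m swap_laplacian A = th *: f -> 0 <= th.
Proof.
move=> f0 fA; have := swap_laplacian_ge0 f A.
by rewrite fA rdotZl pmulr_lge0 // rdot_gt0.
Qed.

(** S has maximal size among the subsets of A whose symmetrizer does not kill f. Singletons qualify
    because their symmetrizer is the identity. *)
Lemma exists_extremal_set f A m : f != 0 -> (m <= #|A|)%N -> killed A m.+1 f ->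
  exists S, [/\ S \subset A, (0 < #|A| -> 0 < #|S|)%N, (#|S| <= m)%N,
     f *m symmetrizer S != 0 & killed A #|S|.+1 f].
Proof.
move=> f0 mA fk; pose P S := (S \subset A) && (f *m symmetrizer S != 0).
have P0 : P set0 by rewrite /P sub0set symmetrizer0 mulmx1.
case: (arg_maxnP (fun S => #|S|) P0) => S /andP[SA fS] Smax.
have Sm : (#|S| <= m)%N.
  rewrite leqNgt; apply: contra_neqN fS => mS.
  have [B /andP[BS /eqP Bm]] : exists B, (B \subset S) && (#|B| == m.+1).
    have : (0 < #|[set B : {set T} | (B \subset S) & (#|B| == m.+1)]|)%N.
      by rewrite cards_draws bin_gt0.
    by case/card_gt0P => B; rewrite inE => ?; exists B.
  by apply: (symmetrizer_ker_sub BS); apply: fk => //; exact: subset_trans SA.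
exists S; split=> //.
  case/card_gt0P => x xA; have := Smax [set x].
  by rewrite /P sub1set xA symmetrizer1 mulmx1 f0 cards1; apply.
move=> B BA Bs; apply/eqP; apply: contraTT isT => fB.
by have := Smax B; rewrite /P BA fB => /(_ isT) /=; rewrite Bs /= => h; lia.
Qed.

(** Induction on |A|. Symmetrizing f over an extremal S gives a nonzero eigenvector g whose
    eigenvalue splits as 2i(|S| + 1) plus an eigenvalue th' of the Laplacian of A \ S, where i = |A
    \ S|. The first bound needs only th' >= 0; the second needs the induction when i > |S|. *)
Lemma eigen_bound A j f th : (0 < j)%N -> f != 0 ->
  f *m swap_laplacian A = th *: f -> (j <= #|A|)%N ->
  killed A (#|A| - j).+1 f ->
  exists i, [/\ (j <= i)%N, (i < #|A|)%N,
    (2 * i * (#|A| - i).+1)%:R <= th & (i * #|A|.+2)%:R <= th].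
Proof.
have [N] := ubnP #|A|; elim: N A j f th => // N IH A j f th AN j0 f0 fA jA fk.
have [S [SA S0 Sj gn0 fkS]] := exists_extremal_set f0 (leq_subr j #|A|) fk.
set g := f *m symmetrizer S in gn0.
have cAS : (#|A :\: S| + #|S| = #|A|)%N.
  by rewrite cardsD (setIidPr SA) subnK // subset_leq_card.
have s0 : (0 < #|S|)%N by apply: S0; lia.
have gA : g *m swap_laplacian A = th *: g.
  by rewrite -mulmxA symmetrizer_swap_laplacian // mulmxA fA -scalemxAl.
have gk : killed A #|S|.+1 g by exact: killed_symmetrizer.
have gS s : s \in Sym S -> g *m rho s = g by exact: symmetrizer_invariant.
have gU u : u \in A :\: S -> g *m symmetrizer (u |: S) = 0.
  rewrite inE => /andP[uS uA]; apply: gk; rewrite ?cardsU1 ?uS //.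
  by apply/subsetP => x /setU1P[->//|/(subsetP SA)].
pose th' := th - (2 * #|A :\: S| * #|S|.+1)%:R.
have gAS : g *m swap_laplacian (A :\: S) = th' *: g.
  have := swap_laplacian_extremal SA gS gU; rewrite gA => e.
  by rewrite /th' scalerBl e addrAC subrr add0r.
have th'0 := eigen_ge0 gn0 gAS.
(* Symmetrizing g over a set B disjoint from S and larger than S leaves a vector fixed by both
   groups and still killed by each [u |: S], hence zero. *)
have gkAS : killed (A :\: S) #|S|.+1 g.
  move=> B BAS Bs; have [BA dSB] : B \subset A /\ [disjoint S & B].
    by move: BAS; rewrite subsetD disjoint_sym => /andP[].
  have BS u : u \in B -> u \in A :\: S by move/(subsetP BAS).
  apply: (@disjoint_symmetrizer_eq0 _ S B) => //; first by rewrite Bs.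
  - move=> s sS; rewrite -mulmxA.
    suff -> : symmetrizer B *m rho s = rho s *m symmetrizer B.
      by rewrite mulmxA gS.
    rewrite /symmetrizer mulmx_suml mulmx_sumr; apply: eq_bigr => t tB.
    rewrite -!rhoM; congr rho.
    by move: sS tB; rewrite !inE => /perm_onC h /h -> //.
  - by move=> s; exact: symmetrizer_invariant.
  - move=> u uB; have uAS := BS u uB.
    move: (uAS); rewrite inE => /andP[uS uA].
    apply: (killed_symmetrizer BA gk); last by rewrite cardsU1 uS.
    by apply/subsetP => x /setU1P[->//|/(subsetP SA)].
exists #|A :\: S|; split; [lia|lia| |].
  have -> : (#|A| - #|A :\: S| = #|S|)%N by lia.
  by rewrite -subr_ge0.
have e (a b : nat) : (a <= b)%N -> b%:R <= th -> a%:R <= th.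
  by move=> ab; apply: le_trans; rewrite ler_nat.
(* With s = |S|, the first term alone suffices if i <= s, since i + s + 2 <= 2(s + 1). *)
have [le|lt] := leqP #|A :\: S| #|S|.
  apply: (e _ (2 * #|A :\: S| * #|S|.+1)%N); first by nia.
  by rewrite -subr_ge0.
(* Otherwise the induction applies with degree i - s and yields th' >= (i - s)(i + 2). *)
have gkAS' : killed (A :\: S) (#|A :\: S| - (#|A :\: S| - #|S|)).+1 g.
  by have -> : (#|A :\: S| - (#|A :\: S| - #|S|) = #|S|)%N by lia.
have [|||i [i1 i2 _ i3]] := IH _ _ g th' _ _ gn0 gAS _ gkAS'; try lia.
have : ((2 * #|A :\: S| * #|S|.+1) + i * #|A :\: S|.+2)%:R <= th.
  by rewrite natrD -lerBrDl.
by apply: e; nia.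
Qed.

End OrthogonalRepresentation.

(** * The degree filtration *)

(** Rows of an invertible matrix are independent; [Q] selects those indexed by J. *)
Lemma card_rows_le_rank (F : fieldType) (d m : nat) (P : 'M[F]_d)
    (B : 'M[F]_(m, d)) (J : {set 'I_d}) :
  P \in unitmx -> (forall l, l \in J -> (row l P <= B)%MS) ->
  (#|J| <= \rank B)%N.
Proof.
move=> Pu JB; pose g (k : 'I_#|J|) := enum_val k.
have g_inj : injective g by exact: enum_val_inj.
pose Q : 'M[F]_(#|J|, d) := rowsub g 1%:M.
have Qfree : row_free Q.
  apply/row_freeP; exists Q^T; apply/matrixP => i k.
  rewrite /Q !mxE (bigD1 (g i)) //= big1 => [|l li]; last first.
    by rewrite !mxE eq_sym (negPf li) mul0r.
  by rewrite !mxE eqxx mul1r addr0 eq_sym (inj_eq g_inj).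
have /eqP <- : \rank (Q *m P) == #|J|.
  by rewrite mxrankMfree // row_free_unit.
apply: mxrankS; rewrite /Q mul_rowsub_mx mul1mx; apply/row_subP => k.
by rewrite row_rowsub JB // /g enum_valP.
Qed.

Section DegreeFiltration.
Variables (R : realFieldType) (T : finType) (d : nat).
Variable rho : {perm T} -> 'M[R]_d.
Hypothesis rho1 : rho 1%g = 1%:M.
Hypothesis rhoM : forall s t, rho (s * t)%g = rho s *m rho t.
Hypothesis rhoV : forall s, (rho s)^T = rho s^-1%g.
Local Notation n := #|T|.
Local Notation L := (swap_laplacian rho [set: T]).

(* The row space of [degree_mx j] is spanned by the vectors fixed by the
   permutations of some subset of size [n - j]. *)
Definition degree_mx j := \sum_(S : {set T} | #|S| == (n - j)%N) symmetrizer rho S.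

Lemma degree_mx_tr j : (degree_mx j)^T = degree_mx j.
Proof.
by rewrite /degree_mx linear_sum; apply: eq_bigr => S _; exact: symmetrizer_tr.
Qed.

Lemma degree_mx_laplacian j : degree_mx j *m L = L *m degree_mx j.
Proof.
rewrite /degree_mx mulmx_suml mulmx_sumr; apply: eq_bigr => S _.
exact: symmetrizer_swap_laplacian (subsetT _).
Qed.

(** The quadratic form of [degree_mx j] is a sum of nonnegative forms, one for each S. If it
    vanishes at f, so does each of them, and each is a squared norm up to a factor. *)
Lemma degree_mx_ker j f : f *m degree_mx j = 0 -> killed rho [set: T] (n - j) f.
Proof.
move=> fF B _ Bm; apply/eqP; rewrite -rdot_eq0 rdot_mulmx symmetrizer_tr //.
rewrite -mulmxA symmetrizer_absorb // -scalemxAr rdotC rdotZl.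
suff -> : rdot (f *m symmetrizer rho B) f = 0 by rewrite mulr0.
have : rdot (f *m degree_mx j) f = 0 by rewrite fF /rdot mul0mx mxE.
rewrite /degree_mx mulmx_sumr rdot_suml => /eqP.
rewrite psumr_eq0 => [/allP/(_ B (mem_index_enum B))|S _]; last exact: symmetrizer_ge0.
by rewrite Bm eqxx /= => /eqP.
Qed.

(** The kernel of a symmetric matrix is orthogonal to its row space, and the ranks add up to d. *)
Lemma degree_mx_ker_im j : (kermx (degree_mx j) + degree_mx j :=: 1%:M)%MS.
Proof.
set F := degree_mx j.
have cap0 : (kermx F :&: F = 0)%MS.
  apply/eqP/rowV0P => v; rewrite sub_capmx => /andP[/sub_kermxP vF /submxP[w ew]].
  apply/eqP; rewrite -rdot_eq0 {1}ew rdot_mulmx degree_mx_tr vF.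
  by rewrite /rdot trmx0 mulmx0 mxE.
apply/eqmxP; rewrite submx1 sub1mx /row_full.
by rewrite mxrank_disjoint_sum // mxrank_ker subnK ?rank_leq_row ?eqxx.
Qed.

(** [L] commutes with the symmetric matrix F, so the component of b in the kernel of F is again an
    eigenvector for th. It is nonzero because b is not in the row space of F, and [eigen_bound]
    applies to it. *)
Lemma eigen_degree (b : 'rV[R]_d) th j : b *m L = th *: b -> (0 < j)%N -> (j <= n)%N ->
  ~~ (b <= degree_mx j.-1)%MS ->
  (2 * j * (n - j).+1)%:R <= th /\ (j * n.+2)%:R <= th.
Proof.
move=> bL j0 jn bF; set F := degree_mx j.-1 in bF.
have /sub_addsmxP[[u v] /= euv] : (b <= kermx F + F)%MS.
  by rewrite degree_mx_ker_im submx1.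
set b1 := u *m kermx F in euv; set b2 := v *m F in euv.
have b1F : b1 *m F = 0 by rewrite -mulmxA mulmx_ker mulmx0.
have b1L : b1 *m L = th *: b1.
  apply/eqP; rewrite -subr_eq0 -rdot_eq0.
  have e : b1 *m L - th *: b1 = (th *: v - v *m L) *m F.
    apply/eqP; rewrite mulmxBl -[v *m L *m F]mulmxA -degree_mx_laplacian.
    rewrite -scalemxAl mulmxA -/b2.
    rewrite subr_eq addrAC eq_sym subr_eq -mulmxDl -scalerDr.
    by rewrite [b2 + b1]addrC -euv bL.
  rewrite {1}e rdot_mulmx degree_mx_tr mulmxBl -scalemxAl -[b1 *m L *m F]mulmxA.
  rewrite -degree_mx_laplacian mulmxA b1F mul0mx scaler0 subr0.
  by rewrite /rdot trmx0 mulmx0 mxE.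
have b10 : b1 != 0.
  by apply: contraNneq bF => b10; rewrite euv b10 add0r /b2 submxMl.
have k : killed rho [set: T] (#|[set: T]| - j).+1 b1.
  have -> : (#|[set: T]| - j).+1 = (n - j.-1)%N by rewrite cardsT; lia.
  exact: degree_mx_ker.
have := eigen_bound rho1 rhoM rhoV j0 b10 b1L _ k; rewrite cardsT => /(_ jn).
case=> i [ji iN i1 i2].
have e (a c : nat) : (a <= c)%N -> c%:R <= th -> a%:R <= th.
  by move=> ac; apply: le_trans; rewrite ler_nat.
have jiN : (j * n.+2 <= i * n.+2)%N by rewrite leq_mul2r ji orbT.
split; last exact: e i2.
move: (n) ji iN i1 i2 jn e => N ji iN i1 i2 jn e.
(* The map x -> 2x(N - x + 1) is symmetric about (N + 1)/2, so it does not decrease from j to i when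
   i + j <= N + 1. Otherwise 2i >= N + 2, and i(N + 2) exceeds its maximum (N + 1)^2/2. *)
have [h|h] := leqP (i + j) N.+1; first by apply: e i1; nia.
by apply: e i2; nia.
Qed.

Hypothesis rank_symmetrizer : forall S, (\rank (symmetrizer rho S) <= n ^ (n - #|S|))%N.

Lemma rank_degree_mx j : (j <= n)%N -> (\rank (degree_mx j) <= 'C(n, j) * n ^ j)%N.
Proof.
move=> jn; rewrite /degree_mx.
have h : (\rank (\sum_(S : {set T} | #|S| == (n - j)%N) symmetrizer rho S)%R
   <= \sum_(S : {set T} | #|S| == (n - j)%N) \rank (symmetrizer rho S))%N.
  elim/big_ind2: _ => [|A a B b hA hB|//]; first by rewrite mxrank0.
  exact: (leq_trans (mxrank_add _ _) (leq_add hA hB)).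
apply: leq_trans h _.
apply: (@leq_trans (\sum_(S : {set T} | #|S| == (n - j)%N) n ^ j)%N).
  apply: leq_sum => S /eqP e; apply: leq_trans (rank_symmetrizer S) _.
  by rewrite e subKn.
by rewrite sum_nat_const -cardsE card_draws bin_sub.
Qed.

(** Sets of size 1 have identity symmetrizer, so only degrees below n occur. *)
Lemma degree_mx_full : (0 < n)%N -> (1%:M <= degree_mx n.-1)%MS.
Proof.
move=> n0; have -> : degree_mx n.-1 = n%:R *: 1%:M.
  rewrite /degree_mx (eq_bigr (fun=> 1%:M)) => [|S /eqP e].
    rewrite sumr_const scaler_nat; congr (_ *+ _).
    by rewrite -cardsE card_draws (_ : n - n.-1 = 1)%N ?bin1 //; lia.
  have /cards1P[x ->] : #|S| == 1%N by rewrite e; lia.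
  exact: symmetrizer1.
by rewrite eqmx_scale // pnatr_eq0; lia.
Qed.

(** Each eigenvector, a row of P, gets the least degree j whose space contains it. Independence of
    the rows bounds the number of eigenvectors of degree j by the rank of [degree_mx j]. *)
Lemma sum_eigen_le (P : 'M[R]_d) (th : 'rV[R]_d) (phi : R -> R) (w : nat -> R) :
  (0 < n)%N -> P \in unitmx -> P *m L = diag_mx th *m P ->
  (forall j, 0 <= w j) ->
  (forall x, 0 <= x -> phi x <= w 0%N) ->
  (forall x j, (0 < j < n)%N -> (2 * j * (n - j).+1)%:R <= x ->
     (j * n.+2)%:R <= x -> phi x <= w j) ->
  \sum_l phi (th 0 l) <= \sum_(j < n) ('C(n, j) * n ^ j)%:R * w j.
Proof.
move=> n0 Pu PL w0 phi0 phij.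
have rowL l : row l P *m L = th 0 l *: row l P.
  by rewrite -row_mul PL mul_diag_mx; apply/rowP => k; rewrite !mxE.
pose deg l := find (fun j => (row l P <= degree_mx j)%MS) (iota 0 n).
have has_deg l : has (fun j => (row l P <= degree_mx j)%MS) (iota 0 n).
  apply/hasP; exists n.-1; first by rewrite mem_iota; lia.
  exact: submx_trans (submx1 _) (degree_mx_full n0).
have deg_lt l : (deg l < n)%N by rewrite -[n in (_ < n)%N](size_iota 0) -has_find.
have deg_in l : (row l P <= degree_mx (deg l))%MS.
  by have := nth_find 0%N (has_deg l); rewrite nth_iota ?add0n //; exact: deg_lt.
have deg_notin l j : (j < deg l)%N -> ~~ (row l P <= degree_mx j)%MS.
  move=> h; have := before_find 0%N h; rewrite nth_iota ?add0n => [->//|].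
  exact: ltn_trans (deg_lt l).
have row_neq0 l : row l P != 0.
  apply/negP => /eqP/(congr1 (mulmx^~ (invmx P))); rewrite -row_mul mulmxV //.
  by rewrite mul0mx => /rowP/(_ l)/eqP; rewrite !mxE eqxx oner_eq0.
apply: (@le_trans _ _ (\sum_l w (deg l))).
  apply: ler_sum => l _; case E: (deg l) => [|j].
    by apply: phi0; apply: eigen_ge0 (rowL l).
  have dl := deg_lt l.
  have [|||h1 h2] := @eigen_degree (row l P) (th 0 l) (deg l) (rowL l); first by lia.
  - exact: ltnW.
  - by apply: deg_notin; lia.
  by apply: phij; rewrite -E //; lia.
rewrite (partition_big (fun l => Ordinal (deg_lt l)) xpredT) //=.
apply: ler_sum => j _.
rewrite (eq_bigr (fun=> w j)) => [|l /eqP <- //].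
rewrite sumr_const -[X in X <= _]mulr_natl ler_wpM2r // ler_nat.
apply: leq_trans (rank_degree_mx (ltnW (ltn_ord j))).
rewrite -cardsE; apply: card_rows_le_rank Pu _ => l.
by rewrite inE => /eqP <-; exact: deg_in.
Qed.

End DegreeFiltration.

(** * The random transposition walk *)

(** The spectral theorem is applied over the complex numbers; the diagonal is real, and real
    matrices similar over the complexes are similar over the reals. *)
Lemma real_spectral (R : rcfType) d (A : 'M[R]_d) : A^T = A ->
  exists2 P : 'M[R]_d, P \in unitmx &
    exists th : 'rV[R]_d, P *m A = diag_mx th *m P.
Proof.
move=> Asym.
have lift_mx m n (B : 'M[R[i]]_(m, n)) : B \is a mxOver Num.real ->
    exists B', B = map_mx (real_complex R) B'.
  move=> Breal; exists (map_mx (@complex.Re R) B); apply/matrixP => i j.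
  by rewrite !mxE RRe_real // (mxOverP Breal).
pose Ac := map_mx (real_complex R) A.
have Areal : Ac \is a mxOver Num.real.
  by apply/mxOverP => i j; rewrite mxE; apply/complex_realP; exists (A i j).
have Aherm : Ac \is hermsymmx.
  apply: realsym_hermsym Areal; apply/is_hermitianmxP.
  by rewrite expr0 scale1r map_mx_id // /Ac map_trmx Asym.
have Dreal := hermitian_spectral_diag_real Aherm.
have [dr edr] := lift_mx _ _ _ Dreal.
have Adiag : similar_in unitmx Ac (diag_mx (spectral_diag Ac)).
  exists (spectralmx Ac); first exact: spectral_unit.
  apply/similarP; first exact: spectral_unit.
  have /orthomx_spectralP e := hermitian_normalmx Aherm.
  rewrite [X in _ *m X = _]e.
  by rewrite !mulmxA mulmxV ?spectral_unit // mul1mx.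
have [|Q] := real_similar Adiag Areal.
  apply/mxOverP => i j; rewrite mxE; case: eqP => _; last by rewrite mulr0n rpred0.
  by rewrite mulr1n (mxOverP Dreal).
rewrite inE => /andP[Qreal Qu] /(similarP Qu) QA.
have [P eP] := lift_mx _ _ _ Qreal.
exists P; first by rewrite -(map_unitmx (real_complex R)) -eP.
exists dr; apply: (map_mx_inj (f := real_complex R)).
by rewrite !map_mxM map_diag_mx -edr -eP.
Qed.

(** * The regular representation and its twist by the sign *)

Section RegularRepresentation.
Variables (R : realType) (T : finType).
Local Notation n := #|T|.
Local Notation d := #|{perm T}|.
Local Notation elt := (@enum_val {perm T} predT).

Definition regular_mx (s : {perm T}) : 'M[R]_d :=
  \matrix_(i, j) (elt i * s == elt j)%g%:R.

Lemma regular_mx_mul m (s : {perm T}) (B : 'M[R]_(d, m)) i k :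
  (regular_mx s *m B) i k = B (enum_rank (elt i * s)%g) k.
Proof.
rewrite mxE (bigD1 (enum_rank (elt i * s)%g)) //= big1 => [|j ji].
  by rewrite mxE enum_rankK eqxx mul1r addr0.
rewrite mxE; case: eqP => [e|_]; last by rewrite mul0r.
by rewrite e enum_valK eqxx in ji.
Qed.

Lemma regular_mx1 : regular_mx 1%g = 1%:M.
Proof.
by apply/matrixP => i j; rewrite !mxE mulg1 (inj_eq enum_val_inj).
Qed.

Lemma regular_mxM s t : regular_mx (s * t)%g = regular_mx s *m regular_mx t.
Proof.
by apply/matrixP => i j; rewrite regular_mx_mul !mxE enum_rankK mulgA.
Qed.

Lemma regular_mxV s : (regular_mx s)^T = regular_mx s^-1%g.
Proof.
apply/matrixP => i j; rewrite !mxE; congr ((nat_of_bool _)%:R); apply/eqP/eqP => <-.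
  by rewrite mulgK.
by rewrite mulgKV.
Qed.


(** The (i, j) entry is 1 exactly when the inverses of elements i and j agree outside S, and 0
    otherwise. Hence the matrix factors through the maps from the complement of S to T. *)
Lemma rank_symmetrizer_regular S :
  (\rank (symmetrizer regular_mx S) <= n ^ (n - #|S|))%N.
Proof.
pose res i := [ffun y : {y | y \notin S} => (elt i)^-1%g (val y)].
pose K := #|{ffun {y | y \notin S} -> T}|.
pose B : 'M[R]_(d, K) := \matrix_(i, k) (res i == enum_val k)%:R.
have -> : symmetrizer regular_mx S = B *m B^T.
  apply/matrixP => i j; transitivity ((res i == res j)%:R : R); last first.
    rewrite mxE (bigD1 (enum_rank (res i))) //= big1 => [|k ki].
      by rewrite !mxE enum_rankK eqxx mul1r addr0 eq_sym.
    rewrite !mxE; case: eqP => [e|_]; last by rewrite mul0r.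
    by rewrite e enum_valK eqxx in ki.
  have -> : (res i == res j) = ((elt i)^-1 * elt j \in Sym S)%g.
    apply/eqP/idP => [e|sS].
      rewrite inE; apply/subsetP => y; rewrite inE permM => ny.
      apply: contraNT ny => yS; have /ffunP/(_ (Sub y yS)) := e.
      by rewrite !ffunE /= => ->; rewrite permKV.
    apply/ffunP => -[y yS]; rewrite !ffunE /=.
    move: sS; rewrite inE => /out_perm /(_ yS); rewrite permM => {2}<-.
    by rewrite permK.
  rewrite /symmetrizer summxE; case: (boolP (_ \in _)) => sS.
    rewrite (bigD1 _ sS) /= big1 => [|s /andP[_ ns]]; rewrite mxE.
      by rewrite mulKVg eqxx addr0.
    by case: eqP => // e; rewrite -e mulKg eqxx in ns.
  rewrite big1 // => s sS'; rewrite mxE; case: eqP => // e.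
  by rewrite -e mulKg sS' in sS.
apply: leq_trans (mxrankM_maxl _ _) _; apply: leq_trans (rank_leq_col _) _.
rewrite /K card_ffun card_sig (_ : #|_| = n - #|S|)%N //.
rewrite -(cardC (mem S)) addKn; apply: eq_card => x.
by rewrite !inE.
Qed.

Definition signed_regular_mx (s : {perm T}) : 'M[R]_d :=
  (-1) ^+ s *: regular_mx s.

Lemma signed_regular_mx1 : signed_regular_mx 1%g = 1%:M.
Proof. by rewrite /signed_regular_mx odd_perm1 expr0 scale1r regular_mx1. Qed.

Lemma signed_regular_mxM s t :
  signed_regular_mx (s * t)%g = signed_regular_mx s *m signed_regular_mx t.
Proof.
rewrite /signed_regular_mx -scalemxAl -scalemxAr scalerA regular_mxM.
by rewrite odd_permM signr_addb.
Qed.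

Lemma signed_regular_mxV s : (signed_regular_mx s)^T = signed_regular_mx s^-1%g.
Proof.
by rewrite /signed_regular_mx linearZ /= regular_mxV odd_permV.
Qed.

(** Conjugation by the diagonal matrix of signs exchanges the two representations. *)
Lemma rank_symmetrizer_signed_regular S :
  (\rank (symmetrizer signed_regular_mx S) <= n ^ (n - #|S|))%N.
Proof.
pose D : 'M[R]_d := diag_mx (\row_i (-1) ^+ elt i).
have -> : symmetrizer signed_regular_mx S = D *m symmetrizer regular_mx S *m D.
  rewrite /symmetrizer mulmx_sumr mulmx_suml; apply: eq_bigr => s _.
  apply/matrixP => i j; rewrite mul_mx_diag mxE mul_diag_mx !mxE.
  case: eqP => [<-|_]; last by rewrite !mulr0 mul0r.
  by rewrite odd_permM signr_addb !mulr1 mulrA -signr_addb addbb mul1r.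
apply: leq_trans (mxrankM_maxl _ _) _; apply: leq_trans (mxrankM_maxr _ _) _.
exact: rank_symmetrizer_regular.
Qed.

(** The transition matrix of the walk that picks p and q independently and uniformly, staying put
    when p = q. *)
Definition transposition_mx : 'M[R]_d :=
  n%:R ^- 2 *: \sum_(p : T) \sum_(q : T) regular_mx (tperm p q).

Local Notation M := transposition_mx.

Hypothesis n_gt0 : (0 < n)%N.

Let nR0 : n%:R != 0 :> R.
Proof. by rewrite pnatr_eq0 -lt0n. Qed.

Lemma transposition_mx_sum :
  \sum_(p : T) \sum_(q : T) regular_mx (tperm p q) = n%:R ^+ 2 *: M.
Proof. by rewrite scalerA divff ?scale1r // expf_neq0. Qed.

Lemma regular_laplacian :
  swap_laplacian regular_mx [set: T] = n%:R ^+ 2 *: (1%:M - M).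
Proof.
rewrite scalerBr -transposition_mx_sum /swap_laplacian.
under eq_bigr do rewrite sumrB.
rewrite sumrB; congr (_ - _).
  by rewrite !sumr_const cardsT -mulrnA -scaler_nat natrM expr2.
under eq_bigl do rewrite inE.
by apply: eq_bigr => p _; apply: eq_bigl => q; rewrite inE.
Qed.

(** A pair p <> q contributes 1 plus its swap matrix, while the n diagonal pairs contribute 0
    instead of 2; this is the source of the 2/n. *)
Lemma signed_regular_laplacian :
  swap_laplacian signed_regular_mx [set: T] =
  n%:R ^+ 2 *: ((1 - 2 / n%:R)%:M + M).
Proof.
rewrite scalerDr -transposition_mx_sum /swap_laplacian.
under eq_bigl do rewrite inE.
transitivity (\sum_(p : T) \sum_(q : T)
   (1%:M + regular_mx (tperm p q) - (p == q)%:R *: 2%:M)).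
  apply: eq_bigr => p _; under eq_bigl do rewrite inE.
  apply: eq_bigr => q _; rewrite /signed_regular_mx odd_tperm.
  case: eqP => [->|_] /=; last by rewrite expr1 scaleN1r opprK scale0r subr0.
  rewrite expr0 tperm1 regular_mx1 !scale1r subrr -[2%:R]/(1 + 1).
  by rewrite raddfD /= subrr.
have delta (p : T) : \sum_(q : T) (p == q)%:R *: (2%:M : 'M[R]_d) = 2%:M.
  rewrite (bigD1 p) //= big1 => [|q qp]; first by rewrite eqxx scale1r addr0.
  by rewrite eq_sym (negPf qp) scale0r.
under eq_bigr => p _ do rewrite sumrB delta big_split /=.
rewrite sumrB big_split /= !sumr_const; set X := \sum_(i in T) _.
rewrite addrAC; congr (_ + _); rewrite -mulrnA -!scaler_nat !scale_scalar_mx.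
rewrite -raddfB /=; congr (_%:M); rewrite mulr1 natrM mulrBr mulr1 expr2.
by congr (_ - _); rewrite mulrCA mulrC !mulrA mulfK.
Qed.

End RegularRepresentation.

(** * Trace and mixing bounds for random transpositions *)

Section TranspositionWalk.
Variables (R : realType) (T : finType).
Local Notation n := #|T|.
Local Notation d := #|{perm T}|.
Local Notation elt := (@enum_val {perm T} predT).
Local Notation M := (transposition_mx R T).
Hypothesis n_gt0 : (0 < n)%N.

Lemma transposition_mx_tr : M^T = M.
Proof.
rewrite /transposition_mx linearZ /= linear_sum /=; congr (_ *: _).
apply: eq_bigr => p _; rewrite linear_sum /=; apply: eq_bigr => q _.
by rewrite regular_mxV tpermV.
Qed.

Definition gap j := maxn (2 * j * (n - j).+1) (j * n.+2).

Lemma expr_max0_le (x t : R) m :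
  t <= x -> Num.max 0 (1 - x) ^+ m <= expR (- (m%:R * t)).
Proof.
move=> tx; rewrite -mulrN expRM_natl; apply: lerXn2r; rewrite ?nnegrE.
- by rewrite le_max lexx.
- exact: expR_ge0.
rewrite ge_max expR_ge0 /=; apply: le_trans (expR_ge1Dx _).
by rewrite lerD2l lerN2.
Qed.

Lemma mxtrace_diagonalizable (P : 'M[R]_d) (A : 'M[R]_d) (r : 'rV_d) m :
  P \in unitmx -> P *m A = diag_mx r *m P -> \tr (A ^+ m) = \sum_l r 0 l ^+ m.
Proof.
move=> Pu PA; have PAm : P *m A ^+ m = diag_mx (\row_l r 0 l ^+ m) *m P.
  elim: m => [|m IH].
    rewrite expr0 mulmx1 mul_diag_mx; apply/matrixP => i j.
    by rewrite !mxE expr0 mul1r.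
  rewrite exprSr mulmxA IH -mulmxA PA !mul_diag_mx; apply/matrixP => i j.
  by rewrite !mxE exprSr mulrA.
have -> : A ^+ m = invmx P *m (diag_mx (\row_l r 0 l ^+ m) *m P).
  by rewrite -PAm mulmxA mulVmx // mul1mx.
rewrite mxtrace_mulC -mulmxA mulmxV // mulmx1 mxtrace_diag.
by apply: eq_bigr => l _; rewrite mxE.
Qed.

Lemma trace_transposition_pow k :
  \tr (M ^+ (2 * k)) <= 1 + expR (- (4 * k%:R / n%:R)) +
   2 * \sum_(1 <= j < n) ('C(n, j) * n ^ j)%:R *
       expR (- (2 * k%:R * ((gap j)%:R / n%:R ^+ 2))).
Proof.
have n0 : 0 < n%:R :> R by rewrite ltr0n.
have n20 : 0 < n%:R ^+ 2 :> R by rewrite exprn_gt0.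
have [P Pu [r PM]] := real_spectral transposition_mx_tr.
rewrite (mxtrace_diagonalizable _ Pu PM).
pose th1 := \row_l (n%:R ^+ 2 * (1 - r 0 l)).
pose th2 := \row_l (n%:R ^+ 2 * (1 - 2 / n%:R + r 0 l)).
have PL1 : P *m swap_laplacian (@regular_mx R T) [set: T] = diag_mx th1 *m P.
  rewrite regular_laplacian // -scalemxAr mulmxBr mulmx1 PM !mul_diag_mx.
  by apply/matrixP => i j; rewrite !mxE; ring.
have PL2 : P *m swap_laplacian (@signed_regular_mx R T) [set: T] = diag_mx th2 *m P.
  rewrite signed_regular_laplacian // -scalemxAr mulmxDr mul_mx_scalar PM !mul_diag_mx.
  by apply/matrixP => i j; rewrite !mxE; ring.
(* An eigenvalue r >= 0 of M has r^(2k) equal to [phi1] at its [th1] value, a negative one equal to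
   [phi2] at its [th2] value; truncation at 0 makes both functions nonincreasing. *)
pose phi1 (x : R) := Num.max 0 (1 - x / n%:R ^+ 2) ^+ (2 * k).
pose phi2 (x : R) := Num.max 0 (1 - (2 / n%:R + x / n%:R ^+ 2)) ^+ (2 * k).
pose w j := expR (- ((2 * k)%:R * ((gap j)%:R / n%:R ^+ 2))) : R.
(* In degree 0 the twisted Laplacian only gives -r <= 1 - 2/n, hence the separate weight. *)
pose w2 j := if j == 0%N then expR (- ((2 * k)%:R * (2 / n%:R))) else w j.
have gap_le x j : (2 * j * (n - j).+1)%:R <= x -> (j * n.+2)%:R <= x ->
    (gap j)%:R / n%:R ^+ 2 <= x / n%:R ^+ 2 :> R.
  by move=> h1 h2; rewrite ler_pM2r ?invr_gt0 // /gap; case: leqP.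
have S1 : \sum_l phi1 (th1 0 l) <= \sum_(j < n) ('C(n, j) * n ^ j)%:R * w j.
  apply: (sum_eigen_le (regular_mx1 R T) (@regular_mxM R T)
    (@regular_mxV R T)) PL1 _ _ _ => //.
  - exact: rank_symmetrizer_regular.
  - by move=> j; exact: expR_ge0.
  - move=> x x0; apply: expr_max0_le.
    by rewrite /gap !mul0n mul0r divr_ge0 // exprn_ge0.
  - by move=> x j _ h1 h2; apply: expr_max0_le; apply: gap_le.
have S2 : \sum_l phi2 (th2 0 l) <= \sum_(j < n) ('C(n, j) * n ^ j)%:R * w2 j.
  apply: (sum_eigen_le (signed_regular_mx1 R T)
    (@signed_regular_mxM R T) (@signed_regular_mxV R T)) PL2 _ _ _ => //.
  - exact: rank_symmetrizer_signed_regular.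
  - by move=> j; rewrite /w2; case: ifP => _; exact: expR_ge0.
  - move=> x x0; apply: expr_max0_le.
    by rewrite lerDl divr_ge0 // exprn_ge0.
  - move=> x j /andP[j0 _] h1 h2; rewrite /w2 gtn_eqF //; apply: expr_max0_le.
    apply: le_trans (gap_le _ _ h1 h2) _.
    by rewrite lerDr divr_ge0.
apply: (@le_trans _ _ (\sum_l (phi1 (th1 0 l) + phi2 (th2 0 l)))).
  apply: ler_sum => l _; rewrite /phi1 /phi2 !mxE.
  have -> : 1 - n%:R ^+ 2 * (1 - r 0 l) / n%:R ^+ 2 = r 0 l.
    by field; rewrite gt_eqF.
  have -> : 1 - (2 / n%:R + n%:R ^+ 2 * (1 - 2 / n%:R + r 0 l) / n%:R ^+ 2) = - r 0 l.
    by field; rewrite gt_eqF.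
  have [r0|r0] := leP 0 (r 0 l).
    by rewrite lerDl exprn_ge0 // le_max lexx.
  rewrite (max_idPr _); last by rewrite oppr_ge0 ltW.
  by rewrite [(- _) ^+ _]exprM sqrrN -exprM lerDr exprn_ge0 // le_max lexx.
rewrite big_split /=; apply: le_trans (lerD S1 S2) _.
rewrite -!(big_mkord xpredT (fun j => ('C(n, j) * n ^ j)%:R * _ j)).
rewrite !(big_ltn n_gt0) /w2 eqxx !bin0 expn0 muln1 !mul1r.
have -> : w 0%N = 1 by rewrite /w /gap !mul0n mul0r mulr0 oppr0 expR0.
rewrite [X in _ + (_ + X)](eq_big_nat _ _ (F2 := fun j =>
  ('C(n, j) * n ^ j)%:R * w j)) => [|j /andP[j0 _]]; last by rewrite gtn_eqF.
rewrite [leLHS](_ : _ = 1 + expR (- ((2 * k)%:R * (2 / n%:R))) +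
  2 * \sum_(1 <= j < n) ('C(n, j) * n ^ j)%:R * w j); last by ring.
have -> : (2 * k)%:R * (2 / n%:R) = 4 * k%:R / n%:R :> R by rewrite natrM; ring.
by rewrite /w natrM.
Qed.

Definition transposition_avg (F : {perm T} -> R) (s : {perm T}) : R :=
  n%:R ^- 2 * \sum_(p : T) \sum_(q : T) F (s * tperm p q)%g.

Lemma iter_transposition_avg k F i :
  iter k transposition_avg F (elt i) = (M ^+ k *m \col_j F (elt j)) i 0.
Proof.
elim: k i => [|k IH] i; first by rewrite expr0 mul1mx mxE.
rewrite iterS exprS -mulmxA /transposition_avg.
rewrite -scalemxAl mxE mulmx_suml summxE; congr (_ * _).
apply: eq_bigr => p _; rewrite mulmx_suml summxE; apply: eq_bigr => q _.
by rewrite regular_mx_mul -IH enum_rankK.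
Qed.

Lemma transposition_mx_entry i j :
  M i j = n%:R ^- 2 * \sum_(p : T) \sum_(q : T)
    ((elt i)^-1 * elt j == tperm p q)%g%:R.
Proof.
rewrite mxE summxE; congr (_ * _); apply: eq_bigr => p _; rewrite summxE.
apply: eq_bigr => q _; rewrite mxE; congr ((nat_of_bool _)%:R).
by apply/eqP/eqP => [<-|<-]; rewrite ?mulKg ?mulKVg.
Qed.

(** M commutes with left translations. This makes the diagonal of [M ^+ m] constant, so that one
    diagonal entry is read off from the trace. *)
Lemma transposition_pow_entry m : exists c : {perm T} -> R,
  forall i j, (M ^+ m) i j = c ((elt i)^-1 * elt j)%g.
Proof.
elim: m => [|m [c IH]].
  exists (fun s => (s == 1%g)%:R) => i j; rewrite expr0 mxE.
  by rewrite -eq_mulVg1 (inj_eq enum_val_inj).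
pose c1 s : R := n%:R ^- 2 * \sum_(p : T) \sum_(q : T) (s == tperm p q)%:R.
exists (fun s => \sum_(g : {perm T}) c g * c1 (g^-1 * s)%g) => i j.
rewrite exprSr mxE (reindex (fun g => enum_rank (elt i * g)%g)) /=; last first.
  exists (fun l => ((elt i)^-1 * elt l)%g) => [g _|l _].
    by rewrite enum_rankK mulKg.
  by rewrite mulKVg enum_valK.
apply: eq_bigr => g _; rewrite IH transposition_mx_entry enum_rankK mulKg.
by rewrite invMg -mulgA.
Qed.

Lemma transposition_pow_diag m i : d%:R * (M ^+ m) i i = \tr (M ^+ m).
Proof.
have [c e] := transposition_pow_entry m.
rewrite /mxtrace (eq_bigr (fun=> (M ^+ m) i i)) => [|j _].
  by rewrite sumr_const card_ord mulr_natl.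
by rewrite !e !mulVg.
Qed.

Lemma transposition_pow_tr m : (M ^+ m)^T = M ^+ m.
Proof.
elim: m => [|m IH]; first by rewrite expr0 trmx1.
by rewrite exprS trmx_mul IH transposition_mx_tr -[LHS]/(M ^+ m * M) -exprSr exprS.
Qed.

Lemma transposition_pow_row_sum m i : \sum_j (M ^+ m) i j = 1.
Proof.
have := iter_transposition_avg m (fun=> 1) i.
have -> : forall s, iter m transposition_avg (fun=> 1) s = 1.
  elim: m => [|m IH] s //; rewrite iterS /transposition_avg.
  under eq_bigr do under eq_bigr do rewrite IH.
  rewrite !sumr_const -mulrnA natrM -expr2 mulVf //.
  by rewrite expf_neq0 // pnatr_eq0 -lt0n.
by rewrite mxE => ->; apply: eq_bigr => j _; rewrite mxE mulr1.
Qed.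

(** The squared entries of a row of [M ^+ k] sum to the trace of [M ^+ (2 * k)] divided by d. A free
    parameter lam in the L1 bound takes the place of Cauchy-Schwarz and avoids square roots. *)
Lemma transposition_avg_mixing k F lam : 0 < lam ->
  (forall s, 0 <= F s <= 1) ->
  `|iter k transposition_avg F 1%g - (\sum_s F s) / d%:R| <=
    ((\tr (M ^+ (2 * k)) - 1) / lam + lam) / 2.
Proof.
move=> lam0 F01; have d0 : 0 < d%:R :> R by rewrite ltr0n; apply/card_gt0P; exists 1%g.
pose i := enum_rank (1%g : {perm T}); pose u j := (M ^+ k) i j.
have -> : iter k transposition_avg F 1%g = \sum_j u j * F (elt j).
  rewrite -[1%g in LHS](@enum_rankK {perm T}) iter_transposition_avg mxE.
  by apply: eq_bigr => j _; rewrite [X in _ * X]mxE.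
have -> : \sum_s F s = \sum_j F (elt j).
  rewrite (reindex elt) //; exists enum_rank => x _; [exact: enum_valK|exact: enum_rankK].
rewrite mulr_suml -sumrB; apply: le_trans (ler_norm_sum _ _ _) _.
have u2 : \sum_j u j ^+ 2 = \tr (M ^+ (2 * k)) / d%:R.
  apply: (mulIf (lt0r_neq0 d0)); rewrite divfK ?gt_eqF // mulrC.
  rewrite -(transposition_pow_diag _ i); congr (_ * _).
  rewrite mul2n -addnn exprD mxE; apply: eq_bigr => j _.
  have -> : (M ^+ k) j i = u j by rewrite -{1}(transposition_pow_tr k) mxE.
  by rewrite expr2.
(* Entrywise AM-GM: 2|x| <= (d / lam) x^2 + lam / d, the difference being (d|x| - lam)^2 / (lam
   d). *)
apply: (@le_trans _ _ (\sum_j ((d%:R / lam) * (u j - d%:R^-1) ^+ 2 + lam / d%:R) / 2)).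
  apply: ler_sum => j _; rewrite [F _ / _]mulrC -mulrBl normrM.
  have /andP[F0 F1] := F01 (elt j).
  apply: (@le_trans _ _ `|u j - d%:R^-1|).
    by rewrite ler_piMr // ger0_norm.
  set x := u j - _; rewrite -(real_normK (num_real x)); set y := `|x|.
  have y0 : 0 <= y by exact: normr_ge0.
  rewrite ler_pdivlMr // -subr_ge0.
  have -> : d%:R / lam * y ^+ 2 + lam / d%:R - y * 2 =
      (d%:R * y - lam) ^+ 2 / (lam * d%:R).
    by field; rewrite !gt_eqF.
  by rewrite divr_ge0 ?sqr_ge0 // mulr_ge0 // ltW.
rewrite -mulr_suml ler_pM2r ?invr_gt0 // big_split /= -mulr_sumr.
have -> : \sum_j (u j - d%:R^-1) ^+ 2 = (\tr (M ^+ (2 * k)) - 1) / d%:R.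
  under eq_bigr do rewrite sqrrB.
  rewrite big_split sumrB /= u2 sumr_const card_ord -[X in _ + X]mulr_natr.
  rewrite (eq_bigr (fun j => 2 * d%:R^-1 * u j)); last first.
    by move=> j _; rewrite -mulr_natl; ring.
  rewrite -mulr_sumr transposition_pow_row_sum; field; exact: lt0r_neq0.
rewrite sumr_const card_ord -[X in _ + X]mulr_natr.
rewrite le_eqVlt; apply/orP; left; apply/eqP.
by field; rewrite !lt0r_neq0.
Qed.

End TranspositionWalk.

(** * Summing the eigenvalue bounds *)

Section Estimates.
Variable R : realType.
Implicit Types (x u c : R) (n j k : nat).

(* Weighted AM-GM, from the tangent line of [expR] at [u * x]. *)
Lemma expR_chord u x : 0 <= u <= 1 -> expR (u * x) <= 1 - u + u * expR x.
Proof.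
move=> /andP[u0 u1]; set a := u * x.
have h0 := expR_ge1Dx (0 - a); have h1 := expR_ge1Dx (x - a).
have e0 : 0 < expR a := expR_gt0 a.
rewrite -[leLHS]mul1r.
have -> : 1 - u + u * expR x = ((1 - u) * expR (0 - a) + u * expR (x - a)) * expR a.
  by rewrite mulrDl -!mulrA -!expRD !subrK expR0 mulr1.
rewrite ler_pM2r //.
have : (1 - u) * (1 + (0 - a)) + u * (1 + (x - a)) <=
  (1 - u) * expR (0 - a) + u * expR (x - a).
  by rewrite lerD // ler_wpM2l // subr_ge0.
apply: le_trans; rewrite le_eqVlt; apply/orP; left; apply/eqP.
by rewrite /a; ring.
Qed.

Lemma exprn_fact_le_expR x n : 0 <= x -> x ^+ n / n`!%:R <= expR x.
Proof.
case: n => [|n] x0; last first.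
  by apply: le_trans (expR_ge1Dxn n x0); rewrite lerDr.
by rewrite expr0 fact0 divr1 -expR0 ler_expR.
Qed.

Lemma bin_le_exprn n j : 'C(n, j)%:R <= n%:R ^+ j / j`!%:R :> R.
Proof.
rewrite ler_pdivlMr ?ltr0n ?fact_gt0 // -natrM -natrX ler_nat bin_ffact.
elim: j n => [|j IH] n; first by rewrite ffactn0.
case: n => [|n]; first by rewrite ffact0n.
rewrite ffactnS expnS leq_mul //; apply: leq_trans (IH _) _.
by case: j {IH} => [|j] //; rewrite leq_exp2r.
Qed.

Lemma bin_le_exp2 n j : ('C(n, j) <= 2 ^ n)%N.
Proof.
have [nj|jn] := ltnP n j; first by rewrite bin_small.
rewrite -[2%N]/(1 + 1)%N expnDn (bigD1 (Ordinal (jn : (j < n.+1)%N))) //=.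
by rewrite !exp1n !muln1 leq_addr.
Qed.

Lemma expR1_ge2 : 2 <= expR 1 :> R.
Proof. by have := expR_ge1Dx (1 : R). Qed.

Lemma expRn_ge n : 2 ^+ n <= expR n%:R :> R.
Proof. by rewrite -[n%:R]mulr1 expRM_natl lerXn2r ?nnegrE ?expR_ge0 // expR1_ge2. Qed.

(** The logarithmic part of the exponent cancels n^(2j) up to a factor e^((j - 1)t) with t = (2j/n)
    log n; the chord bound gives e^t <= 3j, and j! absorbs j^(j - 1) at the cost of e^j. The part
    with c leaves e^(-4c) and a surplus e^(-4(j - 1)); finally 3 e^(-3) <= 1/2. *)
Lemma small_degree_term n j c : 2 <= c -> (0 < j)%N -> (2 * j <= n)%N ->
  ('C(n, j) * n ^ j)%:R *
    expR (- ((ln n%:R + 2 * c) * ((2 * j * (n - j).+1)%:R / n%:R))) <=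
  expR 1 * 2^-1 ^+ j.-1 * expR (- (4 * c)).
Proof.
move=> c2 j0 jn; have n0 : 0 < n%:R :> R by rewrite ltr0n; lia.
set l := ln n%:R; have el : expR l = n%:R by rewrite lnK.
have jf : 0 < j`!%:R :> R by rewrite ltr0n fact_gt0.
have l0 : 0 <= l by rewrite ln_ge0 // ler1n; lia.
have J1 : 1 <= j%:R :> R by rewrite ler1n.
have Jn : 2 * j%:R <= n%:R :> R by rewrite -natrM ler_nat.
have j1E : (j.-1)%:R = j%:R - 1 :> R by rewrite -subn1 natrB.
have npow (i : nat) : n%:R ^+ i = expR (i%:R * l) by rewrite expRM_natl el.
pose t : R := 2 * j%:R / n%:R * l.
have tle : expR t <= 3 * j%:R.
  apply: le_trans (expR_chord _ _) _.
    apply/andP; split; last by rewrite ler_pdivrMr // mul1r.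
    by rewrite divr_ge0 // mulr_ge0.
  rewrite el divfK ?gt_eqF //.
  have : 0 <= 2 * j%:R / n%:R :> R by rewrite divr_ge0 ?mulr_ge0.
  by lra.
have e1 : expR (- ((l + 2 * c) * ((2 * j * (n - j).+1)%:R / n%:R))) <=
    expR (j.-1%:R * t) * expR (- (2 * j%:R * l)) *
      expR (- (4 * j.-1%:R)) * expR (- (4 * c)).
  rewrite -!expRD ler_expR j1E /t.
  have -> : (2 * j * (n - j).+1)%:R = 2 * j%:R * (n%:R - j%:R + 1) :> R.
    by rewrite !natrM -natrB ?natr1 //; lia.
  have -> : (l + 2 * c) * (2 * j%:R * (n%:R - j%:R + 1) / n%:R) =
    2 * j%:R * l - (j%:R - 1) * (2 * j%:R / n%:R * l) + 4 * c
      + 4 * c * ((j%:R - 1) * (n%:R - j%:R) / n%:R).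
    by field; rewrite gt_eqF.
  set X := (j%:R - 1) * (2 * j%:R / n%:R * l).
  suff : j%:R - 1 <= c * ((j%:R - 1) * (n%:R - j%:R) / n%:R) by lra.
  have h : (j%:R - 1) / 2 <= (j%:R - 1) * (n%:R - j%:R) / n%:R :> R.
    by rewrite -mulrA ler_wpM2l ?subr_ge0 // ler_pdivlMr //; lra.
  have : 2 * ((j%:R - 1) / 2) <= c * ((j%:R - 1) * (n%:R - j%:R) / n%:R).
    by apply: ler_pM => //; rewrite divr_ge0 // subr_ge0.
  by lra.
apply: le_trans (ler_wpM2l _ e1) _ => //.
rewrite mulrA ler_wpM2r ?expR_ge0 //.
have e2 : ('C(n, j) * n ^ j)%:R <= expR (2 * j%:R * l) / j`!%:R.
  rewrite natrM natrX; apply: le_trans (ler_wpM2r _ (bin_le_exprn n j)) _.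
    by rewrite exprn_ge0.
  by rewrite mulrAC -exprD npow natrD -mulr2n mulr_natl.
apply: le_trans (ler_wpM2r _ e2) _; first by rewrite !mulr_ge0 ?expR_ge0.
have -> : expR (2 * j%:R * l) / j`!%:R *
    (expR (j.-1%:R * t) * expR (- (2 * j%:R * l)) * expR (- (4 * j.-1%:R))) =
  expR (j.-1%:R * t) / j`!%:R * expR (- (4 * j.-1%:R)).
  have h := expRxMexpNx_1 (2 * j%:R * l).
  set a := expR (2 * j%:R * l) in h *; set b := expR (- (2 * j%:R * l)) in h *.
  rewrite -[RHS]mul1r -h; ring.
have e3 : expR (j.-1%:R * t) / j`!%:R <= 3 ^+ j.-1 * expR j%:R.
  rewrite expRM_natl; apply: (@le_trans _ _ ((3 * j%:R) ^+ j.-1 / j`!%:R)).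
    apply: ler_wpM2r; first by rewrite invr_ge0 ltW.
    by rewrite lerXn2r ?nnegrE ?expR_ge0 ?mulr_ge0.
  rewrite exprMn -mulrA ler_wpM2l ?exprn_ge0 //.
  apply: le_trans (exprn_fact_le_expR j (ler0n _ j)).
  apply: ler_wpM2r; first by rewrite invr_ge0 ltW.
  by rewrite -[X in _ <= _ ^+ X](prednK j0) exprS ler_peMl // exprn_ge0.
apply: le_trans (ler_wpM2r _ e3) _; first by rewrite expR_ge0.
have -> : expR j%:R = expR 1 * expR j.-1%:R :> R by rewrite -expRD j1E addrC subrK.
rewrite [leLHS](_ : _ = expR 1 * (3 ^+ j.-1 *
  (expR j.-1%:R * expR (- (4 * j.-1%:R))))); last by ring.
rewrite ler_wpM2l ?expR_ge0 // -expRD.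
have -> : j.-1%:R + - (4 * j.-1%:R) = j.-1%:R * - 3 :> R by ring.
rewrite expRM_natl -exprMn lerXn2r ?nnegrE ?mulr_ge0 ?expR_ge0 ?invr_ge0 //.
have := expRn_ge 3; rewrite expRN => h; rewrite ler_pdivrMr ?expR_gt0 //.
by lra.
Qed.

(** The factor n^j cancels, the binomial is at most 2^n <= 4^j, and c >= 2 gives 2cj >= 4c + 4(j -
    2). The 32 comes from 4^j e^(-4(j - 2)) = 16 (4 e^(-4))^(j - 2), where 4 e^(-4) <= 1/2. *)
Lemma large_degree_term n j c : 2 <= c -> (1 < j)%N -> (n <= 2 * j)%N -> (0 < n)%N ->
  ('C(n, j) * n ^ j)%:R *
    expR (- ((ln n%:R + 2 * c) * ((j * n.+2)%:R / n%:R))) <=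
  32 * 2^-1 ^+ j.-1 * expR (- (4 * c)).
Proof.
move=> c2 j1 jn n_gt0; have n0 : 0 < n%:R :> R by rewrite ltr0n.
set l := ln n%:R; have el : expR l = n%:R by rewrite lnK.
have l0 : 0 <= l by rewrite ln_ge0 // ler1n; lia.
have e1 : expR (- ((l + 2 * c) * ((j * n.+2)%:R / n%:R))) <=
    expR (- (j%:R * l)) * expR (- (4 * j.-2%:R)) * expR (- (4 * c)).
  rewrite -!expRD ler_expR.
  have -> : j.-2%:R = j%:R - 2 :> R by rewrite -subn2 natrB.
  have h : j%:R <= (j * n.+2)%:R / n%:R :> R.
    by rewrite ler_pdivlMr // -natrM ler_nat leq_mul2l; lia.
  have : (l + 2 * c) * j%:R <= (l + 2 * c) * ((j * n.+2)%:R / n%:R).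
    by apply: ler_wpM2l h; lra.
  have J2 : 2 <= j%:R :> R by rewrite ler_nat.
  have : 0 <= (c - 2) * (j%:R - 2) by rewrite mulr_ge0 ?subr_ge0.
  rewrite mulrBr !mulrBl mulrDl; lra.
apply: le_trans (ler_wpM2l _ e1) _ => //.
rewrite mulrA ler_wpM2r ?expR_ge0 //.
have e2 : ('C(n, j) * n ^ j)%:R <= 4 ^+ j * expR (j%:R * l).
  rewrite natrM natrX expRM_natl el ler_wpM2r ?exprn_ge0 //.
  apply: (@le_trans _ _ (2 ^ n)%:R); first by rewrite ler_nat bin_le_exp2.
  by rewrite -natrX ler_nat -[4%N]/(2 ^ 2)%N -expnM leq_exp2l.
apply: le_trans (ler_wpM2r _ e2) _; first by rewrite !mulr_ge0 ?expR_ge0.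
have h := expRxMexpNx_1 (j%:R * l).
set a := expR (j%:R * l) in h *; set b := expR (- (j%:R * l)) in h *.
have -> : 4 ^+ j * a * (b * expR (- (4 * j.-2%:R))) = 4 ^+ j * expR (- (4 * j.-2%:R)).
  by rewrite -mulrA [a * (b * _)]mulrA h mul1r.
case: j j1 {jn e1 e2 h a b} => [|[|j]] //= _.
rewrite mulrC -mulrN mulrC exprS [4 ^+ _]exprS exprS.
have -> : 4 * - j%:R = j%:R * - 4 :> R by ring.
have e : expR (- 4) * 4 <= 2^-1 :> R.
  have := expRn_ge 4; rewrite expRN => h; rewrite mulrC ler_pdivrMr ?expR_gt0 //.
  by lra.
rewrite expRM_natl; have : (expR (- 4) * 4) ^+ j <= 2^-1 ^+ j :> R.
  by rewrite lerXn2r ?nnegrE ?mulr_ge0 ?expR_ge0 ?invr_ge0.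
rewrite exprMn; set X := expR _ ^+ j; set Y := 4 ^+ j; set Z := 2^-1 ^+ j.
lra.
Qed.

Lemma geometric_half_le n : \sum_(1 <= j < n) 2^-1 ^+ j.-1 <= 2 :> R.
Proof.
suff h m : \sum_(0 <= j < m) 2^-1 ^+ j = 2 - 2 * 2^-1 ^+ m :> R.
  by rewrite big_add1 /= h gerBl mulr_ge0 ?exprn_ge0 ?invr_ge0.
elim: m => [|m IH]; first by rewrite big_geq // expr0; lra.
by rewrite big_nat_recr //= IH exprS; lra.
Qed.

(** The sum is split at 2j = n, each range using its own eigenvalue bound, and compared with a
    geometric series of sum at most 2; this gives 129 + 4e = 1 + 4(32 + e). *)
Lemma degree_sum_le n k c : (0 < n)%N -> 2 <= c ->
  k%:R = 1 / 2 * n%:R * ln n%:R + c * n%:R ->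
  expR (- (4 * k%:R / n%:R)) + 2 * \sum_(1 <= j < n) ('C(n, j) * n ^ j)%:R *
    expR (- (2 * k%:R *
      ((maxn (2 * j * (n - j).+1) (j * n.+2))%:R / n%:R ^+ 2)))
  <= (129 + 4 * expR 1) * expR (- (4 * c)).
Proof.
move=> n_gt0 c2 kE; have n0 : 0 < n%:R :> R by rewrite ltr0n.
have l0 : 0 <= ln n%:R :> R by rewrite ln_ge0 // ler1n.
have K0 : 0 <= 32 + expR 1 :> R by rewrite addr_ge0 ?expR_ge0.
have term j : (1 <= j < n)%N -> ('C(n, j) * n ^ j)%:R *
    expR (- (2 * k%:R * ((maxn (2 * j * (n - j).+1) (j * n.+2))%:R / n%:R ^+ 2)))
    <= (32 + expR 1) * expR (- (4 * c)) * 2^-1 ^+ j.-1.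
  move=> /andP[j0 jn]; set g := maxn _ _.
  have -> : 2 * k%:R * (g%:R / n%:R ^+ 2) = (ln n%:R + 2 * c) * (g%:R / n%:R) :> R.
    by rewrite kE; field; rewrite gt_eqF.
  have mono (a : nat) : (a <= g)%N -> ('C(n, j) * n ^ j)%:R *
      expR (- ((ln n%:R + 2 * c) * (g%:R / n%:R))) <= ('C(n, j) * n ^ j)%:R *
      expR (- ((ln n%:R + 2 * c) * (a%:R / n%:R))).
    move=> ag; rewrite ler_wpM2l // ler_expR lerN2 ler_wpM2l //; first by lra.
    by rewrite ler_pM2r ?invr_gt0 // ler_nat.
  have P0 : 0 <= 2^-1 ^+ j.-1 * expR (- (4 * c)).
    by rewrite mulr_ge0 ?expR_ge0 ?exprn_ge0 ?invr_ge0.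
  have [h|h] := leqP (2 * j) n.
    apply: le_trans (mono _ (leq_maxl _ _)) _.
    apply: le_trans (small_degree_term c2 j0 h) _.
    rewrite -mulrA [leRHS]mulrAC -[leRHS]mulrA; apply: ler_wpM2r => //.
    by rewrite lerDr.
  apply: le_trans (mono _ (leq_maxr _ _)) _.
  apply: le_trans (large_degree_term c2 _ _ n_gt0) _; [by lia|by lia|].
  rewrite -mulrA [leRHS]mulrAC -[leRHS]mulrA; apply: ler_wpM2r => //.
  by rewrite lerDl expR_ge0.
have sum_le := ler_sum_nat term; rewrite -mulr_sumr in sum_le.
have E0 : 0 <= (32 + expR 1) * expR (- (4 * c)) by rewrite mulr_ge0 ?expR_ge0.
have := ler_wpM2l E0 (geometric_half_le n).
have : expR (- (4 * k%:R / n%:R)) <= expR (- (4 * c)).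
  rewrite ler_expR lerN2 kE.
  have -> : 4 * (1 / 2 * n%:R * ln n%:R + c * n%:R) / n%:R = 2 * ln n%:R + 4 * c :> R.
    by field; rewrite gt_eqF.
  by lra.
move: sum_le; set S := \sum_(_ <= _ < _) _; set S' := \sum_(_ <= _ < _) _.
lra.
Qed.

End Estimates.

(** * Reduction from the wreath product to the symmetric group *)

Section MarkovOperator.
Variables (R : realFieldType) (gT : finGroupType).
Implicit Types (P Q f : gT -> R) (k : nat).

Definition markov P f (h : gT) : R := \sum_(a : gT) P a * f (a * h)%g.

Lemma sum_convolution P Q f :
  \sum_g convolution P Q g * f g = \sum_h Q h * markov P f h.
Proof.
rewrite /convolution; under eq_bigr do rewrite mulr_suml.
rewrite exchange_big /=; apply: eq_bigr => h _.
rewrite /markov mulr_sumr (reindex_inj (mulIg h)) /=; apply: eq_bigr => a _.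
by rewrite mulgK; ring.
Qed.

(** Pairing with a test function turns convolution powers into iterates of the dual operator,
    evaluated at the start of the walk. *)
Lemma sum_convolution_pow P f k :
  \sum_g convolution_pow P k g * f g = iter k (markov P) f 1%g.
Proof.
elim: k f => [|k IH] f.
  rewrite (bigD1 1%g) //= eqxx mul1r big1 ?addr0 // => g /negPf.
  by rewrite /convolution_pow /= => ->; rewrite mul0r.
rewrite [convolution_pow _ _]/(convolution P (convolution_pow P k)).
by rewrite sum_convolution IH -iterSr.
Qed.

End MarkovOperator.

(** * Resampling the value of a card *)

Section Wreath.
Variables (R : realFieldType) (gT : finGroupType) (n : nat).
Local Notation W := (wreath gT n).
Local Notation q := (#|gT|%:R : R).
Implicit Types (f g : W -> R) (h a : W) (i j l : 'I_n) (z w : gT).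

Lemma sum_wreath (F : W -> R) :
  \sum_h F h = \sum_(s : 'S_n) \sum_(x : {ffun 'I_n -> gT}) F (Wreath x s).
Proof.
rewrite (reindex (@wreath_of_pair gT n)) /=; last first.
  exists (@wreath_to_pair gT n) => x _.
    exact: wreath_of_pairK.
  exact: wreath_to_pairK.
by rewrite exchange_big pair_big.
Qed.

Definition coordinate j z : W := Wreath [ffun i => if i == j then z else 1%g] 1%g.

Lemma wr_vecM h a i : wr_vec (h * a)%g i = (wr_vec h i * wr_vec a ((wr_perm h)^-1 i))%g.
Proof. by rewrite ffunE. Qed.

Lemma wr_permM h a : wr_perm (h * a)%g = (wr_perm a * wr_perm h)%g.
Proof. by []. Qed.

Lemma wreath_eq h a : wr_perm h = wr_perm a -> wr_vec h =1 wr_vec a -> h = a.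
Proof. by case: h a => x s [y t] /= -> /ffunP ->. Qed.

Lemma coordinateM j z w : (coordinate j z * coordinate j w)%g = coordinate j (z * w)%g.
Proof.
apply: wreath_eq => [|i]; first by rewrite wr_permM mulg1.
by rewrite wr_vecM /= invg1 perm1 !ffunE; case: eqP => // _; rewrite mulg1.
Qed.

Lemma coordinateC i j z w : i != j ->
  (coordinate i z * coordinate j w = coordinate j w * coordinate i z)%g.
Proof.
move=> ij; apply: wreath_eq => [//|l].
rewrite !wr_vecM /= invg1 perm1 !ffunE; case: (eqVneq l i) => [->|_].
  by rewrite (negPf ij) mulg1 mul1g.
by case: eqP => _; rewrite ?mulg1 ?mul1g.
Qed.

(* Right multiplication by [coordinate j z] changes the value of card [j],
   which sits at position [wr_perm h j]. *)
Lemma mul_coordinate h j z :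
  (h * coordinate j z = coordinate (wr_perm h j)
     (wr_vec h (wr_perm h j) * z * (wr_vec h (wr_perm h j))^-1) * h)%g.
Proof.
apply: wreath_eq => [|i]; first by rewrite !wr_permM mul1g mulg1.
rewrite !wr_vecM /= invg1 perm1 !ffunE.
rewrite -(inj_eq (@perm_inj _ (wr_perm h))) permKV.
by case: eqP => [->|_]; rewrite ?mulgKV ?mulg1 ?mul1g.
Qed.

(** The conditional expectation of f once the value of card j is forgotten. Multiplying on the right
    makes it follow the card rather than a position. *)
Definition resample j f h : R := q^-1 * \sum_z f (h * coordinate j z)%g.

Let q0 : q != 0.
Proof. by rewrite pnatr_eq0 -lt0n; apply/card_gt0P; exists 1%g. Qed.

Let qV0 : 0 <= q^-1.
Proof. by rewrite invr_ge0. Qed.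

Lemma resample_invariant j f h w : resample j f (h * coordinate j w)%g = resample j f h.
Proof.
rewrite /resample; congr (_ * _); rewrite [RHS](reindex_inj (mulgI w)) /=.
by apply: eq_bigr => z _; rewrite -mulgA coordinateM.
Qed.

Lemma resample_preserve i j f h z :
  (forall a w, f (a * coordinate j w)%g = f a) ->
  resample i f (h * coordinate j z)%g = resample i f h.
Proof.
move=> fj; have [->|ij] := eqVneq i j; first exact: resample_invariant.
rewrite /resample; congr (_ * _); apply: eq_bigr => w _.
by rewrite -mulgA coordinateC 1?eq_sym // mulgA fj.
Qed.

Lemma resample_id j f h : resample j (resample j f) h = resample j f h.
Proof.
rewrite {1}/resample (eq_bigr (fun=> resample j f h)) => [|z _].
  by rewrite sumr_const -[X in _ * X]mulr_natl mulKf.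
exact: resample_invariant.
Qed.

Lemma resample01 j f : (forall h, 0 <= f h <= 1) -> forall h, 0 <= resample j f h <= 1.
Proof.
move=> f01 h; apply/andP; split.
  by rewrite mulr_ge0 // sumr_ge0 // => z _; case/andP: (f01 (h * coordinate j z)%g).
rewrite -(mulVf q0) ler_wpM2l //.
rewrite -[X in _ <= X%:R]/(#|gT|) -sumr_const; apply: ler_sum => z _.
by case/andP: (f01 (h * coordinate j z)%g).
Qed.

Lemma sum_resample j f : \sum_h resample j f h = \sum_h f h.
Proof.
rewrite -mulr_sumr exchange_big /= (eq_bigr (fun=> \sum_h f h)) => [|z _].
  by rewrite sumr_const -[X in _ * X]mulr_natl mulKf.
by rewrite [RHS](reindex_inj (mulIg (coordinate j z))).
Qed.

(** The walk multiplies on the left and resampling on the right, so they commute. *)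
Lemma markov_resample (P : W -> R) j f h :
  resample j (markov P f) h = markov P (resample j f) h.
Proof.
rewrite /resample /markov exchange_big mulr_sumr; apply: eq_bigr => a _.
rewrite -mulr_sumr mulrCA; congr (_ * (_ * _)).
by apply: eq_bigr => z _; rewrite mulgA.
Qed.

Lemma markovB (P : W -> R) f g h :
  markov P (fun a => f a - g a) h = markov P f h - markov P g h.
Proof. by rewrite /markov -sumrB; apply: eq_bigr => a _; rewrite mulrBr. Qed.

Lemma eq_markov (P : W -> R) f g : f =1 g -> markov P f =1 markov P g.
Proof. by move=> fg h; apply: eq_bigr => a _; rewrite fg. Qed.

Lemma eq_iter_markov (P : W -> R) f g k :
  f =1 g -> iter k (markov P) f =1 iter k (markov P) g.
Proof. by move=> fg; elim: k => // k IH; exact: eq_markov. Qed.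

Lemma iter_markovB (P : W -> R) f g k h :
  iter k (markov P) (fun a => f a - g a) h =
  iter k (markov P) f h - iter k (markov P) g h.
Proof.
elim: k h => // k IH h; rewrite !iterS (eq_markov P IH); exact: markovB.
Qed.

Definition resample_all (s : seq 'I_n) f := foldr resample f s.

Lemma resample_all01 s f : (forall h, 0 <= f h <= 1) ->
  forall h, 0 <= resample_all s f h <= 1.
Proof. by move=> f01; elim: s => //= j s IH; exact: resample01. Qed.

Lemma sum_resample_all s f : \sum_h resample_all s f h = \sum_h f h.
Proof. by elim: s => //= j s IH; rewrite sum_resample. Qed.

Lemma resample_all_invariant s f j : j \in s ->
  forall h z, resample_all s f (h * coordinate j z)%g = resample_all s f h.
Proof.
elim: s => //= i s IH; rewrite inE => /orP[/eqP->|js] h z.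
  exact: resample_invariant.
by apply: resample_preserve => a w; exact: IH.
Qed.

(** Non-identity entries are removed one at a time: by [mul_coordinate], changing the entry at a
    position amounts to a right multiplication for the card there. *)
Lemma coordinate_invariant_perm f :
  (forall j h z, f (h * coordinate j z)%g = f h) ->
  forall h, f h = f (Wreath [ffun=> 1%g] (wr_perm h)).
Proof.
move=> fj h; have [m] := ubnP #|[set i | wr_vec h i != 1%g]|.
elim: m h => // m IH h hm.
have [/existsP[i hi]|] := boolP [exists i, wr_vec h i != 1%g]; last first.
  rewrite negb_exists => /forallP e; congr f; apply: wreath_eq => // i.
  by rewrite ffunE; apply/eqP; rewrite -[_ == _]negbK.
set h' := (coordinate i (wr_vec h i)^-1 * h)%g.
have h'E l : wr_vec h' l = if l == i then 1%g else wr_vec h l.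
  rewrite wr_vecM /= invg1 perm1 ffunE; case: eqP => [->|_]; last by rewrite mul1g.
  by rewrite mulVg.
have hh' : wr_perm h' = wr_perm h by rewrite wr_permM mulg1.
have -> : f h = f h'.
  pose j := (wr_perm h)^-1%g i; pose x := wr_vec h i.
  by rewrite -(fj j h x^-1%g) mul_coordinate permKV mulgV mul1g.
rewrite -hh'; apply: IH.
apply: leq_trans (_ : _ < #|[set l | wr_vec h l != 1%g]|)%N _ => //.
rewrite proper_card //; apply/properP; split.
  by apply/subsetP => l; rewrite !inE h'E; case: (l == i) => //; rewrite eqxx.
by exists i; rewrite !inE // h'E eqxx negbK.
Qed.

End Wreath.

(** * The one-step kernel and its contraction *)

Section IndependentShuffles.
Variables (R : realType) (gT : finGroupType) (n : nat).
Local Notation W := (wreath gT n).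
Local Notation gn := (#|gT|%:R : R).
Local Notation P := (@independent_shuffles R gT n).
Implicit Types (f : W -> R) (h a : W) (i j l p q : 'I_n) (z w : gT).

Definition supported p q : {set {ffun 'I_n -> gT}} :=
  [set x : {ffun 'I_n -> gT} | [forall i, (i \notin [set p; q]) ==> (x i == 1%g)]].

(* One step given the chosen positions [p] and [q], possibly equal. *)
Definition pair_kernel p q a : R :=
  if (wr_perm a == tperm p q) && (wr_vec a \in supported p q)
  then gn ^- #|[set p; q]| else 0.

Let gn0 : gn != 0.
Proof. by rewrite pnatr_eq0 -lt0n; apply/card_gt0P; exists 1%g. Qed.

Lemma pair_kernel_ge0 p q a : 0 <= pair_kernel p q a.
Proof. by rewrite /pair_kernel; case: ifP => // _; rewrite invr_ge0 exprn_ge0. Qed.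

Lemma card_supported p q : #|supported p q| = (#|gT| ^ #|[set p; q]|)%N.
Proof.
rewrite -(card_pffun_on (1%g : gT) (mem [set p; q]) (mem gT)) -cardsE.
apply: eq_card => x; rewrite !inE; apply/forallP/pffun_onP => [h|[h _] i].
  split; last by move=> y _; rewrite inE.
  apply/subsetP => i; rewrite inE /= => xi; apply: contraNT xi => ni.
  by have /implyP/(_ ni) := h i.
apply/implyP; apply: contraNT => xi; apply: (subsetP h).
by rewrite inE.
Qed.

Lemma sum_pair_kernel p q : \sum_a pair_kernel p q a = 1.
Proof.
rewrite sum_wreath (bigD1 (tperm p q)) //= [X in _ + X]big1 => [|s sn]; last first.
  by rewrite big1 // => x _; rewrite /pair_kernel /= (negPf sn).
rewrite addr0 /pair_kernel /= eqxx -big_mkcond /= sumr_const card_supported.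
by rewrite -[LHS]mulr_natr natrX mulVf // expf_neq0.
Qed.

Lemma tperm_eq p q p0 q0 : p0 != q0 -> tperm p q = tperm p0 q0 ->
  ((p, q) == (p0, q0)) || ((p, q) == (q0, p0)).
Proof.
move=> pq0 e; have : tperm p q p0 = q0 by rewrite e tpermL.
rewrite !xpair_eqE; case: tpermP => [-> ->|-> ->|_ _ e']; rewrite ?eqxx ?orbT //.
by rewrite e' eqxx in pq0.
Qed.

(** A step is a uniform ordered pair (p, q) with random values there. For the identity permutation
    only p = q counts: all n positions can produce the group identity, a single one a given vector
    with one non-identity entry. A transposition comes from two ordered pairs, whence the 2. *)
Lemma independent_shufflesE a : (0 < n)%N ->
  P a = n%:R ^- 2 * \sum_p \sum_q pair_kernel p q a.
Proof.
move=> n_gt0; have nR : n%:R != 0 :> R by rewrite pnatr_eq0 -lt0n.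
rewrite /independent_shuffles; set D := [set i | wr_vec a i != 1%g].
have suppE p : (wr_vec a \in supported p p) = (D \subset [set p]).
  rewrite inE setUid; apply/forallP/subsetP => h i.
    by move=> iD; have := h i; move: iD; rewrite !inE => /negPf ->; rewrite implybF negbK.
  by apply/implyP; apply: contraNT => ai; apply: h; rewrite inE.
have [s1|s1] := eqVneq (wr_perm a) 1%g.
  have -> : \sum_p \sum_q pair_kernel p q a = \sum_(p | D \subset [set p]) gn^-1.
    rewrite [RHS]big_mkcond; apply: eq_bigr => p _.
    rewrite (bigD1 p) //= big1 => [|q qp]; last first.
      rewrite /pair_kernel s1; case: eqP => // e.
      by move: qp; rewrite -(tpermL p q) -e perm1 eqxx.
    by rewrite addr0 /pair_kernel s1 tperm1 eqxx suppE setUid cards1 expr1.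
  have [a1|a1] := eqVneq a 1%g.
    have -> : D = set0 by apply/setP => i; rewrite !inE a1 ffunE eqxx.
    rewrite (eq_bigl xpredT) => [|p]; last by rewrite sub0set.
    by rewrite sumr_const card_ord -mulr_natl; field; rewrite nR gn0.
  have D0 : D != set0.
    apply: contraNneq a1 => D0; apply/eqP; apply: wreath_eq => // i.
    by rewrite ffunE; apply/eqP; have := in_set0 i; rewrite -D0 inE => /negbFE.
  case: ifP => [/cards1P[i Di]|/negP D1].
    rewrite Di (big_pred1 i) => [|p]; last by rewrite sub1set inE eq_sym.
    by field; rewrite nR gn0.
  rewrite big_pred0 => [|p]; last first.
    apply/negP; rewrite subset1 (negPf D0) orbF => /eqP Dp.
    by apply: D1; rewrite Dp cards1.
  rewrite mulr0; case: ifP => // /existsP[p /existsP[q /and3P[pq /eqP e _]]].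
  by move: pq; rewrite eq_sym -(tpermL p q) -e s1 perm1 eqxx.
rewrite ifN; last by apply: contraNneq s1 => ->.
rewrite /=; case: ifP => [/existsP[p /existsP[q /and3P[pq /eqP sE sup]]]|nex].
  have supp : wr_vec a \in supported p q by rewrite inE.
  rewrite pair_big /= (bigD1 (p, q)) //= (bigD1 (q, p)) /=; last first.
    by rewrite xpair_eqE negb_and eq_sym pq.
  rewrite big1 => [|[p' q'] /= /andP[n1 n2]]; last first.
    rewrite /pair_kernel; case: ifP => // /andP[/eqP e _].
    by have := tperm_eq pq (etrans (esym e) sE); rewrite (negPf n1) (negPf n2).
  have -> : pair_kernel q p a = pair_kernel p q a.
    by rewrite /pair_kernel /supported [tperm q p]tpermC [[set q; p]]setUC.
  rewrite /pair_kernel sE eqxx supp cards2 pq addr0 /=.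
  by field; rewrite nR gn0.
rewrite big1 ?mulr0 // => p _; rewrite big1 // => q _.
rewrite /pair_kernel; case: ifP => // /andP[/eqP e sup]; suff: false by [].
rewrite -nex; apply/existsP; exists p; apply/existsP; exists q; rewrite e eqxx.
move: sup; rewrite inE => ->; rewrite !andbT.
by apply: contraNneq s1 => pq; rewrite e pq tperm1.
Qed.

Lemma markov_shufflesE f h : (0 < n)%N ->
  markov P f h = n%:R ^- 2 * \sum_p \sum_q markov (pair_kernel p q) f h.
Proof.
move=> n0; rewrite /markov.
under eq_bigr do rewrite independent_shufflesE // -mulrA mulr_suml.
rewrite -mulr_sumr exchange_big; congr (_ * _); apply: eq_bigr => p _ /=.
under eq_bigr do rewrite mulr_suml.
by rewrite exchange_big.
Qed.

Lemma pair_kernel_absorb p q l a w : l \in [set p; q] ->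
  pair_kernel p q (a * coordinate l w)%g = pair_kernel p q a.
Proof.
move=> lpq; rewrite /pair_kernel wr_permM mul1g.
case: eqP => [e|//]; congr (if _ && _ then _ else _); rewrite !inE.
apply: eq_forallb => i; have [//|ipq] := boolP (i \in [set p; q]).
congr (_ ==> (_ == _)); rewrite wr_vecM /= ffunE ifN ?mulg1 // e tpermV.
apply: contraNneq ipq => il; have -> : i = tperm p q l by rewrite -il tpermK.
by move: lpq; rewrite !inE => /orP[]/eqP->; rewrite ?tpermL ?tpermR eqxx ?orbT.
Qed.

(** If card j sits at p or q, the step makes its value uniform, so the result is unchanged by
    resampling j; but that resampling gives 0, since it commutes with the step. *)
Lemma pair_kernel_kill p q f j h : (forall a, resample j f a = 0) ->
  wr_perm h j \in [set p; q] -> markov (pair_kernel p q) f h = 0.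
Proof.
move=> fj hj.
have inv z : markov (pair_kernel p q) f (h * coordinate j z)%g =
    markov (pair_kernel p q) f h.
  rewrite mul_coordinate; set t := coordinate _ _.
  rewrite /markov [RHS](reindex_inj (mulIg t)) /=; apply: eq_bigr => a _.
  by rewrite pair_kernel_absorb // mulgA.
have : resample j (markov (pair_kernel p q) f) h = 0.
  by rewrite markov_resample /markov big1 // => a _; rewrite fj mulr0.
rewrite /resample (eq_bigr _ (fun z _ => inv z)) sumr_const.
by rewrite -[X in _ * X]mulr_natl mulKf.
Qed.

Lemma pair_kernel_norm p q f B h : (forall a, `|f a| <= B) ->
  `|markov (pair_kernel p q) f h| <= B.
Proof.
move=> fB; apply: le_trans (ler_norm_sum _ _ _) _.
rewrite -[B]mul1r -(sum_pair_kernel p q) mulr_suml; apply: ler_sum => a _.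
by rewrite normrM ger0_norm ?pair_kernel_ge0 // ler_wpM2l ?pair_kernel_ge0.
Qed.

Lemma iter_markov_shuffles_norm f B k h : (0 < n)%N ->
  (forall a, `|f a| <= B) -> `|iter k (markov P) f h| <= B.
Proof.
move=> n0 fB; elim: k h => // k IH h; rewrite iterS markov_shufflesE //.
have nR : n%:R != 0 :> R by rewrite pnatr_eq0 -lt0n.
rewrite normrM ger0_norm; last by rewrite invr_ge0 exprn_ge0.
rewrite ler_pdivrMl ?exprn_gt0 ?ltr0n // expr2 -mulrA !mulr_natl.
have -> : B *+ n *+ n = \sum_(p < n) \sum_(q < n) B by rewrite !sumr_const card_ord.
apply: le_trans (ler_norm_sum _ _ _) _; apply: ler_sum => p _.
apply: le_trans (ler_norm_sum _ _ _) _.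
by apply: ler_sum => q _; exact: pair_kernel_norm.
Qed.

(** Only pairs avoiding the position of card j survive: (n - 1)^2 out of n^2. *)
Lemma markov_shuffles_contract f j B h : (0 < n)%N ->
  (forall a, resample j f a = 0) -> (forall a, `|f a| <= B) ->
  `|markov P f h| <= (1 - n%:R^-1) ^+ 2 * B.
Proof.
move=> n0 fj fB; have nR : n%:R != 0 :> R by rewrite pnatr_eq0 -lt0n.
have B0 : 0 <= B := le_trans (normr_ge0 _) (fB h).
rewrite markov_shufflesE // normrM ger0_norm; last by rewrite invr_ge0 exprn_ge0.
have -> : (1 - n%:R^-1) ^+ 2 * B = n%:R ^- 2 * ((n%:R - 1) ^+ 2 * B) by field.
rewrite ler_wpM2l ?invr_ge0 ?exprn_ge0 //.
set l := wr_perm h j.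
have cardl : #|[pred p : 'I_n | p != l]|%:R = n%:R - 1 :> R.
  have -> : #|[pred p : 'I_n | p != l]| = n.-1 by have := cardC1 l; rewrite card_ord.
  by rewrite -subn1 natrB.
apply: le_trans (ler_norm_sum _ _ _) _.
rewrite (bigD1 l) //= big1 ?normr0 ?add0r => [|q _]; last first.
  by apply: pair_kernel_kill fj _; rewrite !inE eqxx.
rewrite expr2 -mulrA -{1}cardl mulr_natl -sumr_const; apply: ler_sum => p pl.
apply: le_trans (ler_norm_sum _ _ _) _.
rewrite (bigD1 l) //= (pair_kernel_kill fj); last by rewrite !inE eqxx orbT.
rewrite normr0 add0r -cardl mulr_natl -sumr_const; apply: ler_sum => q ql.
exact: pair_kernel_norm.
Qed.

Lemma iter_markov_shuffles_contract f j B k h : (0 < n)%N ->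
  (forall a, resample j f a = 0) -> (forall a, `|f a| <= B) ->
  `|iter k (markov P) f h| <= (1 - n%:R^-1) ^+ (2 * k) * B.
Proof.
move=> n0 fj fB.
suff [h1 h2] : (forall a, resample j (iter k (markov P) f) a = 0) /\
    forall a, `|iter k (markov P) f a| <= (1 - n%:R^-1) ^+ (2 * k) * B by exact: h2.
elim: k => [|k [IH1 IH2]]; first by split=> // a; rewrite muln0 expr0 mul1r.
split=> a; rewrite iterS; last first.
  rewrite mulnS exprD -mulrA; exact: markov_shuffles_contract IH1 IH2.
by rewrite markov_resample /markov big1 // => b _; rewrite IH1 mulr0.
Qed.

(** The cards are resampled one at a time. Each difference [g - resample j g] is bounded by 1 and
    vanishes under resampling of j, so it contracts; the sum plays the role of a union bound over
    untouched cards. *)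
Lemma iter_markov_resample_all f s k h : (0 < n)%N -> (forall a, 0 <= f a <= 1) ->
  `|iter k (markov P) f h - iter k (markov P) (resample_all s f) h| <=
  (size s)%:R * (1 - n%:R^-1) ^+ (2 * k).
Proof.
move=> n0 f01; elim: s => [|j s IH] /=; first by rewrite subrr normr0 mul0r.
set g := resample_all s f in IH *; have g01 := resample_all01 s f01.
rewrite -natr1 mulrDl mul1r.
rewrite -[X in `|X|](subrKA (iter k (markov P) g h)).
apply: le_trans (ler_normD _ _) _; apply: lerD => //.
rewrite -iter_markovB -[leRHS]mulr1; apply: (@iter_markov_shuffles_contract _ j) => // a.
  have e : resample j (fun b => g b - resample j g b) a =
      resample j g a - resample j (resample j g) a.
    by rewrite /resample -mulrBr -sumrB.
  by rewrite e resample_id subrr.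
have /andP[h1 h2] := g01 a; have /andP[h3 h4] := resample01 j g01 a.
rewrite ler_norml; move: h1 h2 h3 h4; rewrite -/g; lra.
Qed.

Lemma markov_perm (F : 'S_n -> R) h : (0 < n)%N ->
  markov P (fun a => F (wr_perm a)) h = transposition_avg F (wr_perm h).
Proof.
move=> n0; rewrite markov_shufflesE // /transposition_avg card_ord; congr (_ * _).
apply: eq_bigr => p _; apply: eq_bigr => q _.
rewrite -[RHS]mul1r -(sum_pair_kernel p q) mulr_suml; apply: eq_bigr => a _.
rewrite /pair_kernel; case: ifP => [/andP[/eqP e _]|_]; last by rewrite !mul0r.
by rewrite wr_permM e.
Qed.

Lemma iter_markov_perm (F : 'S_n -> R) k h : (0 < n)%N ->
  iter k (markov P) (fun a => F (wr_perm a)) h =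
  iter k (@transposition_avg R 'I_n) F (wr_perm h).
Proof.
move=> n0; elim: k h => // k IH h; rewrite !iterS -markov_perm //.
exact: eq_markov.
Qed.

End IndependentShuffles.

(** * Assembly of the bounds *)

Lemma transposition_mixing (R : realType) (n k : nat) (c : R) (F : 'S_n -> R) :
  (0 < n)%N -> 2 <= c -> k%:R = 1 / 2 * n%:R * ln n%:R + c * n%:R ->
  (forall s, 0 <= F s <= 1) ->
  `|iter k (@transposition_avg R 'I_n) F 1%g - (\sum_s F s) / n`!%:R| <=
    (65 + 2 * expR 1) * expR (- (2 * c)).
Proof.
move=> n0 c2 kE F01; have n0' : (0 < #|'I_n|)%N by rewrite card_ord.
have := transposition_avg_mixing n0' k (expR_gt0 (- (2 * c))) F01.
have <- : #|{perm 'I_n}| = n`! by rewrite -card_Sn; apply: eq_card.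
move=> /le_trans; apply; have := trace_transposition_pow R n0' k.
rewrite /gap !card_ord; have := degree_sum_le n0 c2 kE.
set S := \sum_(_ <= _ < _) _; set t := \tr _; set lam := expR (- (2 * c)).
have -> : expR (- (4 * c)) = lam ^+ 2.
  by rewrite -expRM_natl; congr expR; ring.
have lam0 : 0 < lam := expR_gt0 _.
set x := expR _; move=> h1 h2.
(* For lam = e^(-2c) the trace minus 1 is at most (129 + 4e) lam^2, so both terms of the mixing
   bound are of order lam; the constant is half of 130 + 4e. *)
have h3 : (t - 1) / lam <= (129 + 4 * expR 1) * lam.
  by rewrite ler_pdivrMr // -mulrA -expr2; lra.
lra.
Qed.

(** Since 1 - 1/n <= e^(-1/n), the exponent is log n - 2k/n = -2c. *)
Lemma expR_contraction (R : realType) (n k : nat) (c : R) : (0 < n)%N ->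
  k%:R = 1 / 2 * n%:R * ln n%:R + c * n%:R ->
  n%:R * (1 - n%:R^-1) ^+ (2 * k) <= expR (- (2 * c)).
Proof.
move=> n_gt0 kE; have n0 : 0 < n%:R :> R by rewrite ltr0n.
have le : 1 - n%:R^-1 <= expR (- n%:R^-1) :> R by apply: expR_ge1Dx.
have h : (1 - n%:R^-1) ^+ (2 * k) <= expR (- n%:R^-1) ^+ (2 * k) :> R.
  by rewrite lerXn2r ?nnegrE ?expR_ge0 // subr_ge0 invf_le1 // ler1n.
apply: le_trans (ler_wpM2l (ltW n0) h) _.
have -> : n%:R * expR (- n%:R^-1) ^+ (2 * k) =
    expR (ln n%:R) * expR ((2 * k)%:R * - n%:R^-1) :> R.
  by rewrite lnK // expRM_natl.
rewrite -expRD ler_expR natrM kE le_eqVlt; apply/orP; left; apply/eqP.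
by field; rewrite gt_eqF.
Qed.

Lemma sum_uniform_wreath (R : realType) (gT : finGroupType) (n : nat)
    (f : wreath gT n -> R) (F : 'S_n -> R) :
  \sum_g f g = \sum_(g : wreath gT n) F (wr_perm g) ->
  \sum_g @uniform_wreath R gT n g * f g = (\sum_s F s) / n`!%:R.
Proof.
move=> e; rewrite /uniform_wreath -mulr_sumr e sum_wreath /=.
rewrite (eq_bigr (fun s => #|gT|%:R ^+ n * F s)) => [|s _].
  rewrite -mulr_sumr; field; rewrite !pnatr_eq0 -!lt0n fact_gt0 expf_neq0 //.
  by rewrite pnatr_eq0 -lt0n; apply/card_gt0P; exists 1%g.
by rewrite sumr_const card_ffun card_ord -[LHS]mulr_natl natrX.
Qed.

Theorem theorem3p6p4 (R : realType) :
  exists2 b : R, 0 < b &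
    forall (gT : finGroupType) (n : nat) (c : R) (k : nat),
      (1 <= n)%N -> 0 < c ->
      k%:R = 1 / 2 * n%:R * ln n%:R + c * n%:R ->
      tv_dist (convolution_pow (@independent_shuffles R gT n) k)
              (@uniform_wreath R gT n)
        <= b * expR (- (2 * c)).
Proof.
have e1 : 0 < expR 1 :> R := expR_gt0 1; have e4 : 0 < expR 4 :> R := expR_gt0 4.
(* The resampling error gives 1 and the symmetric group 65 + 2e; for c < 2, the trivial bound 2 is
   covered by 2 e^4 e^(-2c). *)
exists (66 + 2 * expR 1 + 2 * expR 4) => [|gT n c k n0 c0 kE]; first by lra.
have lam0 : 0 < expR (- (2 * c)) := expR_gt0 _.
(* Handles the default value 0 of the maximum. *)
have b0 : 0 <= (66 + 2 * expR 1 + 2 * expR 4) * expR (- (2 * c)).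
  by rewrite mulr_ge0 ?ltW //; lra.
rewrite /tv_dist; elim/big_ind: _ => // [x y hx hy|S _]; first by rewrite ge_max hx.
pose f (g : wreath gT n) : R := (g \in S)%:R.
have f01 g : 0 <= f g <= 1 by rewrite /f; case: (g \in S); rewrite ?lexx ?ler01.
have sumS (Q : wreath gT n -> R) : \sum_(g in S) Q g = \sum_g Q g * f g.
  rewrite big_mkcond; apply: eq_bigr => g _; rewrite /f.
  by case: (g \in S); rewrite ?mulr1 ?mulr0.
(* With every card resampled, the indicator of S becomes a function of the permutation alone. *)
pose f' := resample_all (enum 'I_n) f.
have f'01 : forall g, 0 <= f' g <= 1 by exact: resample_all01.
pose F s := f' (Wreath [ffun=> 1%g] s).
have f'F g : f' g = F (wr_perm g).
  apply: coordinate_invariant_perm => j h z; apply: resample_all_invariant.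
  by rewrite mem_enum.
have F01 s : 0 <= F s <= 1 by exact: f'01.
have U : \sum_g @uniform_wreath R gT n g * f g = (\sum_s F s) / n`!%:R.
  apply: sum_uniform_wreath; rewrite -(sum_resample_all (enum 'I_n) f).
  by apply: eq_bigr => g _; exact: f'F.
have h1 := iter_markov_resample_all (enum 'I_n) k 1%g n0 f01.
rewrite size_enum_ord -/f' in h1.
have {}h1 := le_trans h1 (expR_contraction n0 kE).
rewrite (eq_iter_markov _ _ f'F) iter_markov_perm // in h1.
rewrite !sumS U sum_convolution_pow.
set m := iter k _ f 1%g in h1 *; set m' := iter k _ F _ in h1 *.
set u := _ / _.
have [c2|c2] := leP 2 c.
  have := transposition_mixing n0 c2 kE F01; rewrite -/u -/m' => h2.
  rewrite -[m - u](subrKA m'); apply: le_trans (ler_normD _ _) _.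
  apply: le_trans (lerD h1 h2) _.
  have : 0 <= expR 4 * expR (- (2 * c)) by rewrite mulr_ge0 ?expR_ge0.
  lra.
have m1 : `|m| <= 1.
  apply: iter_markov_shuffles_norm => // a; have /andP[? ?] := f01 a.
  by rewrite ger0_norm.
have u1 : `|u| <= 1.
  rewrite ger0_norm; last by rewrite divr_ge0 // sumr_ge0 // => s _; case/andP: (F01 s).
  rewrite ler_pdivrMr ?ltr0n ?fact_gt0 // mul1r -card_Sn -sumr_const.
  by apply: ler_sum => s _; case/andP: (F01 s).
apply: le_trans (ler_normB _ _) _.
have : 1 <= expR 4 * expR (- (2 * c)) by rewrite -expRD -[leLHS]expR0 ler_expR; lra.
have : 0 <= expR 1 * expR (- (2 * c)) by rewrite mulr_ge0 ?expR_ge0.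
lra.
Qed.
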